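(* Let $\mathcal{D}:= \{ (X,x,y) \in \mathsf{LC}(Q) \times Q \times Q \, ; \ x,y \in X, \ x \neq y \}$, with the subspace topology inherited from $\mathsf{LC}(Q) \times Q \times Q$. There exists a Borel measurable mapping $A \colon \mathcal{D} \to \mathcal{K}(Q)$ such that for every $(X,x,y) \in \mathcal{D}$, the set $A(X,x,y)$ is an arc contained in $X$ whose endpoints are $x$ and $y$.
   Context: $Q = [0,1]^{\mathbb{N}}$ is the Hilbert cube (product topology). A continuum is a nonempty compact connected metrizable space; a Peano continuum is a locally connected continuum. $\mathcal{K}(Q)$ is the space of all nonempty compact subsets of $Q$ with the Vietoris topology (equivalently, the topology of the Hausdorff metric), and $\mathsf{LC}(Q) \subseteq \mathcal{K}(Q)$ is the subspace of all Peano continua contained in $Q$. An arc is a homeomorphic copy of $[0,1]$; its endpoints are the images of $0$ and $1$. A mapping between topological spaces is Borel measurable if preimages of open sets are Borel. *)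

(* Defs.v *)
From HB Require Import structures.
From mathcomp Require Import all_boot all_order all_algebra.
From mathcomp Require Import all_classical all_reals all_analysis.

Set Implicit Arguments.
Unset Strict Implicit.
Unset Printing Implicit Defensive.

Import Order.TTheory GRing.Theory Num.Theory.
Import numFieldNormedType.Exports.

Local Open Scope classical_set_scope.
Local Open Scope ring_scope.

Definition homeomorphism (S T : topologicalType) (f : S -> T) : Prop :=
  continuous f /\ exists g : T -> S, [/\ cancel f g, cancel g f & continuous g].

Definition metrizable (R : realType) (T : topologicalType) : Prop :=
  exists (M : metricType R) (f : T -> M), homeomorphism f.

Definition locally_connected (T : topologicalType) : Prop :=
  forall (x : T) (U : set T), nbhs x U ->
    exists V : set T, [/\ open V, V x, connected V & V `<=` U].

Definition continuum (R : realType) (T : topologicalType) : Prop :=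
  [/\ [set: T] !=set0, compact [set: T], connected [set: T] & metrizable R T].

Definition peano_continuum (R : realType) (T : topologicalType) : Prop :=
  continuum R T /\ locally_connected T.

(* As a type, a set carries the subspace topology (the initial topology of the
   inclusion), both here and below. *)
Definition unit_interval (R : realType) : topologicalType :=
  set_type `[0 : R, 1]%classic.

Lemma unit_interval0_subproof (R : realType) : (0 : R) \in `[0 : R, 1]%classic.
Proof. by apply/mem_set; rewrite /= in_itv /= lexx ler01. Qed.

Lemma unit_interval1_subproof (R : realType) : (1 : R) \in `[0 : R, 1]%classic.
Proof. by apply/mem_set; rewrite /= in_itv /= lexx ler01. Qed.

Definition unit_interval0 (R : realType) : unit_interval R :=
  exist _ 0 (unit_interval0_subproof R).

Definition unit_interval1 (R : realType) : unit_interval R :=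
  exist _ 1 (unit_interval1_subproof R).

Definition hilbert_cube (R : realType) : topologicalType :=
  {ptws nat -> unit_interval R}.

Definition arc_with_endpoints (R : realType) (T : topologicalType)
    (S : set T) (x y : T) : Prop :=
  exists h : unit_interval R -> set_type S,
    [/\ homeomorphism h, set_val (h (unit_interval0 R)) = x &
        set_val (h (unit_interval1 R)) = y].

Record hyperspace (T : topologicalType) := Hyperspace {
  hyperspace_set :> set T ;
  hyperspace_nonempty : hyperspace_set !=set0 ;
  hyperspace_compact : compact hyperspace_set }.

Definition vietoris_subbase (T : topologicalType) : set (set (hyperspace T)) :=
  [set [set K : hyperspace T | K `<=` U] | U in @open T] `|`
  [set [set K : hyperspace T | K `&` U !=set0] | U in @open T].

HB.instance Definition _ (T : topologicalType) :=
  gen_eqMixin (hyperspace T).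
HB.instance Definition _ (T : topologicalType) :=
  gen_choiceMixin (hyperspace T).
HB.instance Definition _ (T : topologicalType) :=
  isSubBaseTopological.Build (hyperspace T) (@vietoris_subbase T) id.

Definition LC (R : realType) : set (hyperspace (hilbert_cube R)) :=
  [set K : hyperspace (hilbert_cube R) | peano_continuum R (set_type K)].
Arguments LC : clear implicits.

Definition arc_domain (R : realType) :
    set (LC R * hilbert_cube R * hilbert_cube R) :=
  [set p : LC R * hilbert_cube R * hilbert_cube R |
    let: (X, x, y) := p in
    [/\ hyperspace_set (set_val X) x, hyperspace_set (set_val X) y & x <> y]].
Arguments arc_domain : clear implicits.

Definition borel_measurable (S T : topologicalType) (f : S -> T) : Prop :=
  forall U : set T, open U -> <<s @open S >> (f @^-1` U).

(* Main.v *)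
Require Import Defs.
From mathcomp Require Import all_boot all_order all_algebra.
From mathcomp Require Import all_classical all_reals all_analysis.
From mathcomp Require Import lra.
From mathcomp Require finmap.

(** The arc is traced by a path chosen, for each triple [(X, x, y)], by a
    sequence of closed conditions; Borel measurability is carried along the
    choice.

    Scales. A Peano continuum [X] is uniformly locally connected. Cover the
    cube, at each level [l], by finitely many small open sets, the pixels. For
    every [n] there is [k] such that, at all levels from [k] on, two pixels hit
    by [X] that are [k]-near are joined by a chain of overlapping pixels, all
    hit by [X] and [n]-near to the first one ([connected_scale_exists]). This
    is a statement about countably many events of the form: [X] meets a given
    pixel. So the least such [k], called [kappa n], is a Borel function of
    [X]. A shortest chain visits every pixel at most once, hence its length is
    bounded by a number that depends on the level only. Refining chains over
    and over therefore yields paths from [x] to [y] in [X] whose modulus of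
    continuity is a function of [kappa] alone ([approximate_path]).

    Selection. The paths from [x] to [y] in [X] with this modulus form a
    nonempty compact subset of the space of all maps from the unit interval
    to the cube, compact for pointwise convergence. This subset depends on
    the triple measurably: the triples for which it meets a given closed set
    form a Borel set. The property survives when a compact-valued map is cut
    down greedily by a sequence of closed sets, each one imposed whenever
    this leaves something ([greedy_refinement]). The outcome is
    lexicographically minimal. The first sequence asks the path to be nearly
    still on rational intervals. When a path returns at time [t] to where it
    was at time [s], resting there in between spoils neither the modulus nor
    any stillness condition and gains a new one, unless the path was already
    at rest. So minimal paths are loop-free. A second sequence of closed sets
    singles out one path.

    Arcs. A loop-free path has intervals as fibres. A weighted sum of running
    oscillations is a continuous monotone function with the same fibres, so
    the image of the path is homeomorphic to the unit interval
    ([loop_free_arc]).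

    Measurability. The image of the chosen path meets a pixel if and only if
    the path is in it at some rational time, a Borel event. Every Vietoris
    open set is a countable union of classes of compact sets that hit
    prescribed pixels at one level ([vietoris_pixels]). *)

Set Implicit Arguments.
Unset Strict Implicit.
Unset Printing Implicit Defensive.

Import Order.TTheory GRing.Theory Num.Theory.
Import numFieldNormedType.Exports.

Local Open Scope classical_set_scope.

(** * Sigma-algebras and compact-valued maps *)

Section sigma_algebras.
Variables (D : Type) (B : set (set D)).
Hypothesis sB : sigma_algebra setT B.

Lemma sigC A : B A -> B (~` A).
Proof. by case: sB => _ sC _ BA; rewrite -setTD; exact: sC. Qed.

Lemma sig_bigcup (I : countType) (F : I -> set D) :
  (forall i, B (F i)) -> B [set d | exists i, F i d].
Proof.
move=> BF; case: sB => B0 _ Bcup.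
rewrite (_ : [set d | _] =
  \bigcup_n (if unpickle n is Some i then F i else set0)).
  by apply: Bcup => n; case: (unpickle n).
apply/seteqP; split=> d /=.
  by move=> [i Fi]; exists (pickle i) => //=; rewrite pickleK.
by move=> [n _]; case: (unpickle n) => // i; exists i.
Qed.

Lemma sig_bigcap (I : countType) (F : I -> set D) :
  (forall i, B (F i)) -> B [set d | forall i, F i d].
Proof.
move=> BF; rewrite (_ : [set d | _] = ~` [set d | exists i, (~` F i) d]).
  by apply/sigC/sig_bigcup => i; exact/sigC.
apply/seteqP; split=> d /= H; first by move=> [i]; apply.
by move=> i; apply: contrapT => nF; apply: H; exists i.
Qed.

Lemma sigI A1 A2 : B A1 -> B A2 -> B [set d | A1 d /\ A2 d].
Proof.
move=> B1 B2; rewrite (_ : [set d | _] =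
    [set d | forall b : bool, (if b then A1 else A2) d]).
  by apply: sig_bigcap => -[].
apply/seteqP; split=> d /= => [[? ?] []//|H].
by split; [exact: (H true)|exact: (H false)].
Qed.

Lemma sig_cst (P : Prop) : B [set _ | P].
Proof.
have [p|np] := pselect P.
  rewrite (_ : [set _ | P] = ~` set0); last by apply/seteqP; split=> d // _ [].
  by apply: sigC; case: sB.
by rewrite (_ : [set _ | P] = set0); [case: sB|apply/seteqP; split=> d].
Qed.

(** The events cut the space into finitely many atoms, and the condition is a
    union of atoms. *)
Lemma sig_finpred (I : finType) (h : D -> I -> Prop) (P : pred {set I}) :
  (forall i, B [set d | h d i]) ->
  B [set d | P [set i | `[< h d i >]]%SET].
Proof.
move=> Bh; rewrite (_ : [set d | _] = [set d | exists S : {set I},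
    P S /\ forall i, (i \in S) = `[< h d i >]]).
  apply: sig_bigcup => S; apply: sigI; first exact: sig_cst.
  apply: sig_bigcap => i; case: (boolP (i \in S)) => iS.
    rewrite [X in B X](_ : _ = [set d | h d i]) //.
    by apply/seteqP; split=> d /=; [move/esym/asboolP|move/asboolP].
  rewrite [X in B X](_ : _ = ~` [set d | h d i]); first exact/sigC.
  apply/seteqP; split=> d /=; first by move/esym/asboolP.
  by move=> nh; apply/esym/asboolF.
apply/seteqP; split=> d /=.
  by move=> PS; eexists; split; [exact: PS|move=> i; rewrite inE].
by move=> [S [PS SE]]; rewrite (_ : [set i | _]%SET = S) //; apply/setP => i;
  rewrite inE SE.
Qed.

End sigma_algebras.

Lemma compact_nested (Z : topologicalType) (A : nat -> set Z) :
  compact [set: Z] -> (forall n, closed (A n)) ->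
  (forall n, A n.+1 `<=` A n) -> (forall n, A n !=set0) ->
  exists z, forall n, A n z.
Proof.
move=> cZ clA decA neA; apply: contrapT => noz.
have dec m n : (m <= n)%N -> A n `<=` A m.
  move/subnK <-; elim: (n - m)%N => // k IH z; rewrite addSn => /decA; exact: IH.
have /compact_near_coveringP/(_ nat \oo (fun n z => ~ A n z)) := cZ.
case.
  move=> z _; have [n nAz] : exists n, ~ A n z.
    by apply: contrapT => H; apply: noz; exists z => n; apply: contrapT => ?;
      apply: H; exists n.
  exists (~` A n, [set k | (n <= k)%N]) => /=.
    split; last by exists n.
    by apply: open_nbhs_nbhs; split=> //; exact/closed_openC.
  by move=> [z' k] /= [nA nk] /(dec _ _ nk).
move=> n _ /(_ n (leqnn n)) sub.
by have [z Az] := neA n; exact: (sub z).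
Qed.

Section multifunctions.
Variables (D : Type) (B : set (set D)) (Z : topologicalType).
Hypotheses (sB : sigma_algebra setT B) (cZ : compact [set: Z]).

(** Effros measurability of a compact-valued map. For a map with one-point
    values this says that preimages of closed sets are measurable. *)
Definition hits_measurable (F : D -> set Z) :=
  forall C, closed C -> B [set d | F d `&` C !=set0].

Lemma hits_measurable_meet F (a : D -> nat) (G : nat -> set Z) :
  hits_measurable F -> (forall k, B [set d | a d = k]) ->
  (forall k, closed (G k)) -> hits_measurable (fun d => F d `&` G (a d)).
Proof.
move=> mF ma clG C clC; rewrite (_ : [set d | _] =
    [set d | exists k, a d = k /\ F d `&` (G k `&` C) !=set0]).
  apply: (sig_bigcup sB) => k; apply: (sigI sB (ma k));
    exact: (mF _ (closedI (clG k) clC)).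
by apply/seteqP; split=> d /=; [exists (a d); rewrite setIA|move=> [k [<-]];
  rewrite setIA].
Qed.

(** For nested compact sets, meeting a closed set may be tested at each stage
    separately. This is where compactness buys measurability. *)
Lemma hits_measurable_nested (F : nat -> D -> set Z) :
  (forall n, hits_measurable (F n)) -> (forall n d, closed (F n d)) ->
  (forall n d, F n.+1 d `<=` F n d) ->
  hits_measurable (fun d => [set z | forall n, F n d z]).
Proof.
move=> mF clF decF C clC; rewrite (_ : [set d | _] =
    [set d | forall n, F n d `&` C !=set0]).
  by apply: (sig_bigcap sB) => n; exact: (mF n _ clC).
apply/seteqP; split=> d /=; first by move=> [z [Fz Cz]] n; exists z; split.
move=> ne; have [||z Fz] := @compact_nested _ (fun n => F n d `&` C) cZ _ _ ne.
- by move=> n; exact: closedI.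
- by move=> n z [/decF].
- by exists z; split=> [n|]; [case: (Fz n)|case: (Fz 0%N)].
Qed.

Fixpoint greedy (F : D -> set Z) (G : nat -> set Z) (n : nat) : D -> set Z :=
  if n is n'.+1 then fun d =>
    let K := greedy F G n' d in
    K `&` (if `[< K `&` G n' !=set0 >] then G n' else setT)
  else F.

(** The values that remain agree on every [G n], since the greedy process
    settles each [G n] one way or the other. They are also minimal: a point
    [z'] that belongs to at least the same sets as [z] survives all the stages
    that [z] survives, so a set containing [z'] must have been imposed on [z]
    as well. *)
Lemma greedy_refinement F (G : nat -> set Z) :
  hits_measurable F -> (forall d, closed (F d)) -> (forall d, F d !=set0) ->
  (forall n, closed (G n)) ->
  exists F' : D -> set Z,
    [/\ hits_measurable F', forall d, closed (F' d), forall d, F' d !=set0,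
        forall d, F' d `<=` F d &
        (forall d z z' n, F' d z -> F' d z' -> G n z -> G n z') /\
        (forall d z z', F' d z -> F d z' -> (forall n, G n z -> G n z') ->
          forall n, G n z' -> G n z)].
Proof.
move=> mF clF neF clG; pose K := greedy F G.
have hit n d : K n d `&` G n !=set0 -> K n.+1 d = K n d `&` G n.
  by move=> H; rewrite /K /= -/K asboolT.
have miss n d : ~ (K n d `&` G n !=set0) -> K n.+1 d = K n d.
  by move=> H; rewrite /K /= -/K asboolF // setIT.
have clK n d : closed (K n d).
  elim: n d => [|n IH] d; first exact: clF.
  have [/hit ->|/miss -> //] := pselect (K n d `&` G n !=set0).
  exact: closedI.
have neK n d : K n d !=set0.
  elim: n d => [|n IH] d; first exact: neF.
  by have [/[dup] H /hit ->|/miss ->] := pselect (K n d `&` G n !=set0).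
have decK n d : K n.+1 d `<=` K n d by move=> z [].
have mK n : hits_measurable (K n).
  elim: n => // n IH.
  pose a d : nat := `[< K n d `&` G n !=set0 >].
  pose G' k := if k is 0%N then setT else G n.
  have -> : K n.+1 = fun d => K n d `&` G' (a d).
    apply/funext => d; have [H|H] := pselect (K n d `&` G n !=set0).
      by rewrite hit // /a asboolT.
    by rewrite miss // /a asboolF // setIT.
  have mA : B [set d | K n d `&` G n !=set0] by exact: (IH _ (clG n)).
  apply: hits_measurable_meet => //; last first.
    by case=> [|k]; [exact: closedT|exact: clG].
  case=> [|[|k]].
  - rewrite [X in B X](_ : _ = ~` [set d | K n d `&` G n !=set0]).
      exact: (sigC sB).
    by apply/seteqP; split=> d; rewrite /= /a; case: asboolP.
  - rewrite [X in B X](_ : _ = [set d | K n d `&` G n !=set0]) //.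
    by apply/seteqP; split=> d; rewrite /= /a; case: asboolP.
  - rewrite [X in B X](_ : _ = [set _ | False]); first exact: sig_cst.
    by apply/seteqP; split=> d; rewrite /= /a; case: asboolP.
exists (fun d => [set z | forall n, K n d z]); split.
- exact: hits_measurable_nested.
- move=> d; rewrite (_ : [set z | _] = \bigcap_n K n d).
    by apply: closed_bigI => n _.
  by apply/seteqP; split=> z /= H; [move=> n _|move=> n]; exact: H.
- by move=> d; apply: compact_nested.
- by move=> d z /(_ 0%N).
split=> [d z z' n Kz Kz' Gz|d z z' Kz Fz' GG n Gz'].
  have H : K n d `&` G n !=set0 by exists z.
  by have := Kz' n.+1; rewrite hit // => -[].
have Kz' m : K m d z'.
  elim: m => // m IH; have [H|H] := pselect (K m d `&` G m !=set0).
    rewrite hit //; split=> //; apply: GG.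
    by have := Kz m.+1; rewrite hit // => -[].
  by rewrite miss.
have H : K n d `&` G n !=set0 by exists z'.
by have := Kz n.+1; rewrite hit // => -[].
Qed.

End multifunctions.

(** * Compact spaces with a countable uniformity *)

(** A countable base of a Hausdorff uniformity whose entourages are closed,
    indexed so that each one contains the square of the next. The level [0] is
    trivial; this lets truncated subtraction on levels lose information without
    case distinctions. *)
Record closed_uniformity (T : topologicalType) (E : nat -> T -> T -> Prop) :
  Prop := ClosedUniformity {
  cu_full : forall p q, E 0%N p q ;
  cu_refl : forall n p, E n p p ;
  cu_sym : forall n p q, E n p q -> E n q p ;
  cu_split : forall n p q r, E n.+1 p q -> E n.+1 q r -> E n p r ;
  cu_sep : forall p q, (forall n, E n p q) -> p = q ;
  cu_nbhs : forall n p, nbhs p (E n p) ;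
  cu_closed : forall n, closed [set pq : T * T | E n pq.1 pq.2] }.

Section uniformity.
Variables (T : topologicalType) (E : nat -> T -> T -> Prop).
Hypotheses (hE : closed_uniformity E) (cT : compact [set: T]).

Lemma cu_mono m n p q : (m <= n)%N -> E n p q -> E m p q.
Proof.
move/subnK <-; elim: (n - m)%N => // k IH; rewrite addSn => Epq; apply: IH.
exact: (cu_split hE Epq (cu_refl hE _ _)).
Qed.

Lemma cu_split_pred n p q r : E n p q -> E n q r -> E n.-1 p r.
Proof.
by case: n => [_ _|n]; [exact: cu_full|exact: (cu_split hE)].
Qed.

Lemma cu_split_pred2 n p q r s : E n p q -> E n q r -> E n r s -> E (n - 2) p s.
Proof.
move=> pq qr rs; rewrite subn2; apply: (@cu_split_pred _ _ r).
  exact: cu_split_pred pq qr.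
by apply: cu_mono rs; exact: leq_pred.
Qed.

Lemma cu_closed_at n p : closed (E n p).
Proof.
have -> : E n p = (fun q : T => (p, q)) @^-1` [set pq : T * T | E n pq.1 pq.2]
  by [].
apply: preimage_closed; last exact: cu_closed.
move=> x _; apply: (@cvg_pair _ _ _ (nbhs x) (nbhs p) (nbhs x)).
- exact: cvg_cst.
- exact: cvg_id.
Qed.

(** In a compact space the closed sets [E n p] shrink to [p], hence they
    eventually enter any open set around [p]. *)
Lemma cu_base p U : nbhs p U -> exists n, E n p `<=` U.
Proof.
rewrite nbhsE => -[V [oV Vp] VU].
suff [n nV] : exists n, E n p `<=` V.
  by exists n => q /nV /VU.
apply: contrapT => noV.
have [|||q Aq] := @compact_nested _ (fun n => E n p `&` ~` V) cT.
- by move=> n; apply: closedI; [exact: cu_closed_at|exact: open_closedC].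
- by move=> n q [Eq nVq]; split => //; exact: cu_mono (leqnSn n) Eq.
- move=> n; apply: contrapT => H; apply: noV; exists n => q Eq.
  by apply: contrapT => nVq; apply: H; exists q.
have pq : p = q by apply: (cu_sep hE) => n; case: (Aq n).
by case: (Aq 0%N) => _; rewrite -pq.
Qed.

Lemma cu_hausdorff : hausdorff_space T.
Proof.
move=> p q pq; apply: (cu_sep hE) => n.
have [r [pr qr]] := pq _ _ (cu_nbhs hE n.+1 p) (cu_nbhs hE n.+1 q).
exact: (cu_split hE pr (cu_sym hE qr)).
Qed.

Lemma compact_uniform_nbhs (K U : set T) : compact K -> open U -> K `<=` U ->
  exists n, forall p q, K p -> E n p q -> U q.
Proof.
move=> cK oU KU.
have /compact_near_coveringP/(_ nat \oo (fun n p => forall q, E n p q -> U q))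
  := cK.
case.
  move=> p Kp; have [n nU] := cu_base (open_nbhs_nbhs (conj oU (KU p Kp))).
  exists (E n.+1 p, [set k | (n.+1 <= k)%N]).
    by split; [exact: cu_nbhs|exists n.+1].
  move=> [p' k] /= [pp' nk] q /(cu_mono nk) p'q; apply: nU.
  exact: (cu_split hE pp' p'q).
by move=> n _ /(_ n (leqnn n)) H; exists n => p q /H; apply.
Qed.

(** Finite open covers, one for each level. Pixels are open, so that the
    compact sets that hit a given pixel form an open set of the hyperspace, and
    a path visits a pixel as soon as it does so at some rational time. *)
Record pixels (N : nat -> nat) (O : forall l, 'I_(N l) -> set T) : Prop :=
  Pixels {
  pixel_open : forall l i, open (O l i) ;
  pixel_cover : forall l p, exists i, O l i p ;
  pixel_small : forall l i p q, O l i p -> O l i q -> E l p q }.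

Lemma pixels_exist : exists N (O : forall l, 'I_(N l) -> set T), pixels O.
Proof.
have fin l : exists s : seq T, forall p, exists2 a, a \in s & (E l.+1 a)° p.
  pose F : set_system (seq T) := filter_from setT (fun s : seq T => [set s' :
    seq T | {subset s <= s'}]).
  have FF : Filter F.
    apply: filter_from_filter; first by exists [::].
    move=> s1 s2 _ _; exists (s1 ++ s2) => // s' H; split => x xs; apply: H;
      by rewrite mem_cat xs ?orbT.
  have /compact_near_coveringP/(_ _ F
    (fun s p => exists2 a, a \in s & (E l.+1 a)° p)) := cT.
  case.
    move=> p _; exists ((E l.+1 p)°, [set s | {subset [:: p] <= s}]).
      split; last by exists [:: p].
      by apply: open_nbhs_nbhs; split; [exact: open_interior|exact: (cu_nbhs hE)].
    by move=> [p' s] /= [pp' ps]; exists p => //; apply: ps; rewrite inE.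
  by move=> s _ /(_ s (fun _ h => h)) H; exists s => p; exact: H.
pose s l := projT1 (cid (fin l)).
have sP l : forall p, exists2 a, a \in s l & (E l.+1 a)° p := projT2 (cid (fin l)).
exists (fun l => size (s l)), (fun l i => (E l.+1 (tnth (in_tuple (s l)) i))°).
split=> [l i|l p|l i p q /interior_subset ip /interior_subset iq].
- exact: open_interior.
- have [a /(nthP a) [i il <-] ap] := sP l p.
  by exists (Ordinal il); rewrite (tnth_nth a).
- exact: (cu_split hE (cu_sym hE ip) iq).
Qed.

End uniformity.

(** * Chains of pixels *)

Section chains.
Variables (T : topologicalType) (E : nat -> T -> T -> Prop).
Variables (N : nat -> nat) (O : forall l, 'I_(N l) -> set T).
Hypotheses (hE : closed_uniformity E) (cT : compact [set: T]).
Hypothesis hO : pixels E O.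

Definition hit l (K : set T) : {set 'I_(N l)} :=
  [set i | `[< K `&` O i !=set0 >]]%SET.

Lemma hitP l (K : set T) (i : 'I_(N l)) :
  reflect (K `&` O i !=set0) (i \in hit l K).
Proof. by rewrite inE; exact: asboolP. Qed.

Definition near_pixels l n (i j : 'I_(N l)) :=
  exists p q, [/\ O i p, O j q & E n p q].

Definition corridor l n (S : {set 'I_(N l)}) i : rel 'I_(N l) :=
  fun a b => [&& b \in S, `[< near_pixels n i b >] & `[< O a `&` O b !=set0 >]].

(** Uniform local connectedness as seen by the pixels. Quantifying over
    pixels instead of points makes this a countable combination of the events
    that [K] hits a pixel. *)
Definition connected_scale (K : set T) n k := forall l, (k <= l)%N ->
  forall i j, i \in hit l K -> j \in hit l K -> near_pixels k i j ->
  connect (corridor n (hit l K) i) i j.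

Lemma connected_scale_measurable (D : Type) (B : set (set D))
    (X : D -> set T) n k :
  sigma_algebra setT B ->
  (forall l i, B [set d | X d `&` O (l := l) i !=set0]) ->
  B [set d | connected_scale (X d) n k].
Proof.
move=> sB BX.
pose P l (S : {set 'I_(N l)}) := (k <= l)%N ==> [forall i, forall j,
  (i \in S) ==> (j \in S) ==> `[< near_pixels k i j >] ==>
  connect (corridor n S i) i j].
rewrite [X in B X](_ : _ = [set d | forall l, P l (hit l (X d))]).
  apply: (sig_bigcap sB) => l.
  exact: (@sig_finpred _ _ sB _ (fun d i => X d `&` O i !=set0) (P l)).
apply/seteqP; split=> d /= H l.
  apply/implyP => kl; apply/forallP => i; apply/forallP => j.
  apply/implyP => iS; apply/implyP => jS; apply/implyP => /asboolP; exact: H.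
move=> kl i j iS jS ij; have /implyP/(_ kl)/forallP/(_ i)/forallP/(_ j) := H l.
by rewrite iS jS asboolT.
Qed.

Lemma connected_scale_mono K n k k' :
  (k <= k')%N -> connected_scale K n k -> connected_scale K n k'.
Proof.
move=> kk' H l k'l i j iS jS [p [q [ip jq pq]]].
apply: H => //; first exact: leq_trans k'l.
by exists p, q; split=> //; exact: (cu_mono hE kk').
Qed.

(** The pixels reachable from [i] and the unreachable ones would otherwise
    separate [V] into two relatively open parts. *)
Lemma connected_corridor K V l n (i j : 'I_(N l)) :
  connected V -> V `<=` K -> V `&` O i !=set0 -> V `&` O j !=set0 ->
  (forall v, V v -> exists2 p, O i p & E n p v) ->
  connect (corridor n (hit l K) i) i j.
Proof.
move=> cV VK [u [Vu Ou]] [w [Vw Ow]] nV; set e := corridor _ _ _.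
pose U1 := \bigcup_(b in [set b | connect e i b]) O b.
pose U2 := \bigcup_(b in [set b | ~~ connect e i b]) O b.
have step v b b' : V v -> O b v -> O b' v -> connect e i b -> connect e i b'.
  move=> Vv bv b'v ib; apply: connect_trans ib (connect1 _).
  apply/and3P; split.
  - by apply/hitP; exists v; split=> //; exact: VK.
  - apply/asboolP; have [p ip pv] := nV v Vv.
    by exists p, v.
  - by apply/asboolP; exists v.
have VU : V `&` U1 = V.
  apply: cV.
  - by exists u; split=> //; exists i => //=; exact: connect0.
  - exists U1 => //; apply: bigcup_open => b _; exact: (pixel_open hO).
  - exists (~` U2).
      by apply/open_closedC/bigcup_open => b _; exact: (pixel_open hO).
    apply/seteqP; split=> v [Vv Uv]; split=> //.
      case: Uv => b ib bv [b' /negP ib' b'v].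
      by apply: ib'; exact: (step v b b').
    have [b bv] := pixel_cover hO l v.
    exists b => //=; case: (boolP (connect e i b)) => // ib.
    by exfalso; apply: Uv; exists b.
have [_ [b ib bw]] : (V `&` U1) w by rewrite VU.
exact: (step w b j).
Qed.

(** At the trivial level all points are near, and connectedness of [K] itself
    joins any two pixels. *)
Lemma connected_scale0 K : connected K -> connected_scale K 0 0.
Proof.
move=> cK l _ i j; move=> /hitP iK /hitP jK _.
apply: (@connected_corridor K K l 0%N i j cK (fun _ h => h) iK jK) => v Kv.
by case: iK => p [_ ip]; exists p => //; exact: (cu_full hE).
Qed.

(** Two points of [K] that are close enough lie in a common small connected
    set, with a uniform bound by compactness; its pixels form the corridor. *)
Lemma connected_scale_exists K n : compact K ->
  (forall p U, K p -> nbhs p U -> exists V W, [/\ V `<=` K `&` U, connected V,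
     nbhs p W & K `&` W `<=` V]) ->
  exists k, connected_scale K n k.
Proof.
move=> cK lcK.
have /compact_near_coveringP/(_ nat \oo (fun k p => K p -> forall q, K q ->
  E k p q -> exists V, [/\ V `<=` K, connected V, V p, V q &
    forall v, V v -> E n p v])) := cK.
case.
  move=> p Kp; have [V [W [VK cV pW WV]]] := lcK p _ Kp (cu_nbhs hE n.+1 p).
  have [k kW] := cu_base hE cT pW.
  exists (E k.+1 p, [set m | (k.+1 <= m)%N]).
    by split; [exact: (cu_nbhs hE)|exists k.+1].
  move=> [p' m] /= [pp' km] Kp' q Kq p'q.
  have Vp' : V p' by apply: WV; split=> //; apply/kW/(cu_mono hE (leqnSn k)).
  exists V; split=> //.
  - by move=> v /VK [].
  - by apply: WV; split=> //; apply/kW/(cu_split hE pp')/(cu_mono hE km).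
  - move=> v /VK [_ pv]; apply: (cu_split hE _ pv).
    by apply: (cu_sym hE); case: (VK _ Vp').
(* Two levels pay for moving from the near points of two pixels to points of
   [K] in the same pixels. *)
move=> k _ /(_ k (leqnn k)) Hk; exists (k + 2)%N => l kl i j.
move=> /hitP [p [Kp ip]] /hitP [q [Kq jq]] [p' [q' [ip' jq' p'q']]].
have kpq : E k p q.
  rewrite -(addnK 2 k); apply: (cu_split_pred2 hE _ p'q').
    exact/(cu_mono hE kl)/(pixel_small hO ip ip').
  exact/(cu_mono hE kl)/(pixel_small hO jq' jq).
have [V [VK cV Vp Vq nV]] := Hk p Kp Kp q Kq kpq.
apply: (connected_corridor cV) => //.
- by exists p.
- by exists q.
- by move=> v Vv; exists p => //; exact: nV.
Qed.

(** A chain of pixels without repetition has at most [N l] members. Choosing a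
    point of [K] in each of them, and repeating the last point, gives chains
    that all have the same length; this is what makes the moduli uniform. *)
Lemma connected_scale_chain K n k l p q :
  connected_scale K n k -> (k <= l)%N -> (n <= l)%N -> K p -> K q -> E k p q ->
  exists z : nat -> T, [/\ z 0%N = p, z (N l) = q, forall a, K (z a),
    forall a, E (n - 2) p (z a) & forall a, E l.-1 (z a) (z a.+1)].
Proof.
move=> sK kl nl Kp Kq pq.
have [i ip] := pixel_cover hO l p; have [j jq] := pixel_cover hO l q.
have iK : i \in hit l K by apply/hitP; exists p.
have jK : j \in hit l K by apply/hitP; exists q.
have /(connectP) [s0 s0P s0j] := sK l kl i j iK jK (ex_intro _ p (ex_intro _ q
  (And3 ip jq pq))).
case/shortenP: s0P s0j => s sP us _ sj {s0}.
have sN : (size s < N l)%N.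
  by have := max_card (mem (i :: s)); rewrite (card_uniqP us) card_ord.
(* Beyond the end of the path of pixels, the default value stays at [j]. *)
pose c a := nth j (i :: s) a.
have c0 : c 0%N = i by [].
have cS a : (a < size s)%N -> corridor n (hit l K) i (c a) (c a.+1).
  by move/pathP: sP => /(_ j) H /H.
have cj a : (size s <= a)%N -> c a = j.
  rewrite leq_eqVlt => /predU1P [<-|sa]; last by rewrite /c nth_default.
  by rewrite /c -last_nth -sj.
have hc a : K `&` O (c a) !=set0.
  case: a => [|a]; first by exists p.
  have [sa|/cS/and3P[/hitP//]] := leqP (size s) a.
  by rewrite cj; [exists q|exact: leqW].
have nc a : near_pixels n i (c a).
  have nci : near_pixels n i i by exists p, p; split=> //; exact: (cu_refl hE).
  elim: a => [//|a IH]; have [sa|/cS/and3P[_ /asboolP//]] := leqP (size s) a.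
  by rewrite cj ?(leqW sa) // -(cj a sa).
have oc a : O (c a) `&` O (c a.+1) !=set0.
  have [sa|/cS/and3P[_ _ /asboolP//]] := leqP (size s) a.
  by rewrite !cj ?(leqW sa) //; exists q.
pose z a := if a == 0%N then p else if (a <= size s)%N then projT1 (cid (hc a))
  else q.
have zP a : K (z a) /\ O (c a) (z a).
  rewrite /z; case: eqP => [->//|_]; case: leqP => sa.
    exact: projT2 (cid (hc a)).
  by rewrite cj // ltnW.
exists z; split=> //.
- by rewrite /z gtn_eqF ?(leq_ltn_trans _ sN) // leqNgt sN.
- by move=> a; case: (zP a).
- move=> a; have [u [v [iu cv uv]]] := nc a; have [_ ca] := zP a.
  apply: (cu_split_pred2 hE _ uv).
    exact/(cu_mono hE nl)/(pixel_small hO ip iu).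
  exact/(cu_mono hE nl)/(pixel_small hO cv ca).
- move=> a; have [u [u1 u2]] := oc a; have [_ z1] := zP a; have [_ z2] := zP a.+1.
  by apply: (cu_split_pred hE (pixel_small hO z1 u1));
    exact: (pixel_small hO u2 z2).
Qed.

End chains.

(** * Approximate paths with a prescribed modulus *)

Definition ival (R : realType) (t : unit_interval R) : R := set_val t.

Lemma ival_ge0 (R : realType) (t : unit_interval R) : (0 <= ival t)%R.
Proof. by case: t => t tP; have := set_mem tP; rewrite /= in_itv /= => /andP[]. Qed.

Lemma ival_le1 (R : realType) (t : unit_interval R) : (ival t <= 1)%R.
Proof. by case: t => t tP; have := set_mem tP; rewrite /= in_itv /= => /andP[]. Qed.

Section approximate_paths.
Variables (R : realType) (T : topologicalType) (E : nat -> T -> T -> Prop).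
Variables (N : nat -> nat) (O : forall l, 'I_(N l) -> set T).
Hypotheses (hE : closed_uniformity E) (hO : pixels E O).

(** The number of steps that replace one step of the chain of level [n]. The
    pixel level is fine enough for the scale [kappa n] to apply and for the new
    steps to be of size [kappa n.+1]. *)
Definition arity (kappa : nat -> nat) n := N (kappa n + kappa n.+1).+1.

Fixpoint cells (kappa : nat -> nat) n :=
  if n is n'.+1 then (cells kappa n' * arity kappa n')%N else 1%N.

(** The loss of [5] levels pays for comparing two points of a refined chain
    with their ancestors in the chain of level [i], and these ancestors, equal
    or consecutive, with one another. *)
Definition modulus i a : set (unit_interval R -> T) :=
  [set g | forall s t, (`|ival s - ival t| * a%:R <= 1)%R ->
    E (i - 5) (g s) (g t)].

Variables (K : set T) (kappa : nat -> nat) (x y : T).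
Hypotheses (Kx : K x) (Ky : K y) (kappa0 : kappa 0%N = 0%N).
Hypothesis kappaP : forall n, (n <= kappa n)%N /\ connected_scale E O K n (kappa n).

Let m := arity kappa.

Let link_spec n p q (z : nat -> T) := K p -> K q -> E (kappa n) p q ->
  [/\ z 0%N = p, z (m n) = q, forall a, K (z a),
    forall a, E (n - 2) p (z a) & forall a, E (kappa n.+1) (z a) (z a.+1)].

Let link_exists n p q : exists z, link_spec n p q z.
Proof.
have [h|h] := pselect [/\ K p, K q & E (kappa n) p q]; last first.
  by exists (fun _ => p) => Kp Kq pq; exfalso; apply: h.
have [Kp Kq pq] := h; have [nk sk] := kappaP n.
have [||z [z0 z1 Kz zn zs]] := connected_scale_chain hE hO (l := (kappa n +
  kappa n.+1).+1) sk _ _ Kp Kq pq.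
- by rewrite ltnW // ltnS leq_addr.
- by rewrite (leq_trans nk) // ltnW // ltnS leq_addr.
- exists z => _ _ _; split => // a.
  exact: (cu_mono hE (leq_addl _ _) (zs a)).
Qed.

Let link n p q := projT1 (cid (link_exists n p q)).

Let linkP n p q : link_spec n p q (link n p q).
Proof. exact: projT2 (cid (link_exists n p q)). Qed.

Let m_gt0 n : (0 < m n)%N.
Proof. by have [i _] := pixel_cover hO (kappa n + kappa n.+1).+1 x;
  apply: leq_ltn_trans (ltn_ord i). Qed.

(** The chain of level [n] has [cells kappa n] steps; its step number [c] is
    replaced by the part of the next chain between the indices [c * m n] and
    [c.+1 * m n]. *)
Let Fixpoint z n : nat -> T :=
  if n is n'.+1 then
    fun c => link n' (z n' (c %/ m n')) (z n' (c %/ m n').+1) (c %% m n')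
  else fun c => if c == 0%N then x else y.

Let zP n : (forall c, K (z n c)) /\ (forall c, E (kappa n) (z n c) (z n c.+1)).
Proof.
elim: n => [|n [IHK IHE]].
  split=> c; last by rewrite kappa0; exact: (cu_full hE).
  by rewrite /=; case: ifP.
have L a : link_spec n (z n a) (z n a.+1) (link n (z n a) (z n a.+1)) by exact:
  linkP.
split=> c /=; have [l0 lm lK ln ls] := L (c %/ m n) (IHK _) (IHK _) (IHE _);
  first exact: lK.
have := ltn_pmod c (m_gt0 n); rewrite leq_eqVlt => /predU1P [cm|cm].
  have E1 : c.+1 = ((c %/ m n).+1 * m n)%N by rewrite mulSn addnC {1}(divn_eq c
    (m n)) -addnS cm.
  have [l0' _ _ _ _] := L (c %/ m n).+1 (IHK _) (IHK _) (IHE _).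
  by have := ls (c %% m n)%N; rewrite cm lm E1 mulnK // modnMl l0'.
have E1 : c.+1 = (c %/ m n * m n + (c %% m n).+1)%N by rewrite addnS -divn_eq.
have -> : (c.+1 %/ m n = c %/ m n)%N by rewrite E1 divnMDl ?m_gt0 //
  (divn_small cm) addn0.
have -> : (c.+1 %% m n = (c %% m n).+1)%N by rewrite {1}E1 modnMDl (modn_small cm).
exact: ls.
Qed.

Let linkz n c := linkP ((zP n).1 c) ((zP n).1 c.+1) ((zP n).2 c).

Let z_start n : z n 0%N = x.
Proof.
elim: n => //= n IH; rewrite div0n mod0n.
by have [-> _ _ _ _] := linkz n 0%N.
Qed.

Let z_end n : z n (cells kappa n) = y.
Proof.
elim: n => //= n IH; rewrite -/(m n) (mulnK _ (m_gt0 n)) modnMl.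
by have [-> _ _ _ _] := linkz n (cells kappa n).
Qed.

Let Fixpoint subcells i r : nat := if r is r'.+1 then (m i * subcells i.+1
  r')%N else 1%N.

Let cellsD i r : cells kappa (i + r) = (cells kappa i * subcells i r)%N.
Proof.
elim: r i => [|r IH] i; first by rewrite addn0 muln1.
by rewrite -addSnnS IH /= mulnA.
Qed.

Let subcells_gt0 i r : (0 < subcells i r)%N.
Proof. by elim: r i => //= r IH i; rewrite muln_gt0 m_gt0 IH. Qed.

(** The errors of the successive refinements form a geometric series: each
    refinement at level [i] moves points by [i - 2], and the halving of
    entourages absorbs all later ones into [i - 3]. *)
Let z_ancestor i r c : E (i - 3) (z i (c %/ subcells i r)) (z (i + r) c).
Proof.
elim: r i c => [|r IH] i c; first by rewrite addn0 divn1; exact: (cu_refl hE).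
rewrite -addSnnS /= mulnC divnMA; set c' := (c %/ _)%N.
have [_ _ _ ln _] := linkz i (c' %/ m i)%N.
have {}ln := ln (c' %% m i)%N.
have := cu_split_pred hE ln; rewrite -subnS; apply; have := IH i.+1 c.
by rewrite subSS.
Qed.

(** The step functions of the refined chains. They are not continuous, but they
    satisfy any finite number of the conditions that define the modulus, which
    is enough in view of the compactness of the space of all maps. *)
Lemma approximate_path n : exists g : unit_interval R -> T,
  [/\ g (unit_interval0 R) = x, g (unit_interval1 R) = y, forall t, K (g t) &
    forall i, (i <= n)%N -> modulus i (cells kappa i) g].
Proof.
pose M := cells kappa.
exists (fun t => z n (Num.truncn (ival t * (M n)%:R)%R)); split.
- by rewrite /ival set_valE /= mul0r truncn0.
- by rewrite /ival set_valE /= mul1r natrK.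
- by move=> t; exact: (zP n).1.
move=> i /subnK; rewrite addnC; move: (n - i)%N => r <- s t st.
set D := subcells i r.
have D0 : (0 < D%:R :> R)%R by rewrite ltr0n subcells_gt0.
have anc (u : unit_interval R) : E (i - 3)
    (z i (Num.truncn (ival u * (M i)%:R)%R)) (z (i + r) (Num.truncn (ival u *
      (M (i + r))%:R)%R)).
  set c := Num.truncn (_ * (M (i + r)%N)%:R)%R.
  suff -> : Num.truncn (ival u * (M i)%:R)%R = (c %/ D)%N by exact: z_ancestor.
  have /andP[c1 c2] : (c%:R <= ival u * (M (i + r))%:R < c.+1%:R)%R.
    by apply: truncn_itv; rewrite mulr_ge0 // ival_ge0.
  move: c1 c2; rewrite /M cellsD natrM mulrA -/D => c1 c2.
  apply: truncn_def; rewrite -(ler_pM2r D0) -(ltr_pM2r D0) -!natrM; apply/andP;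
    split.
    by apply: le_trans c1; rewrite ler_nat leq_trunc_div.
  apply: lt_le_trans c2 _; rewrite ler_nat ltn_ceil //; exact: subcells_gt0.
(* From [s] to its ancestor, to the ancestor of [t], to [t]. *)
rewrite -[5%N]/(3 + 2)%N subnDA.
apply: (cu_split_pred2 hE (cu_sym hE (anc s)) _ (anc t)).
apply: (cu_mono hE (leq_subr 3 i)); apply: (cu_mono hE (kappaP i).1).
have close (u v : unit_interval R) : (`|ival u - ival v| * (M i)%:R <= 1)%R ->
    (Num.truncn (ival u * (M i)%:R)%R <= (Num.truncn (ival v * (M i)%:R)%R).+1)%N.
  move=> uv; rewrite -ltnS -(ltr_nat R).
  have /andP[u1 _] := truncn_itv (mulr_ge0 (ival_ge0 u) (ler0n R (M i))).
  have /andP[_ v2] := truncn_itv (mulr_ge0 (ival_ge0 v) (ler0n R (M i))).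
  apply: (le_lt_trans u1); rewrite -natr1.
  apply: le_lt_trans (ltr_leD v2 (lexx 1%R)).
  rewrite -lerBlDl -mulrBl; apply: le_trans uv; rewrite ler_wpM2r //;
    exact: ler_norm.
have := close s t st; rewrite distrC in st; have := close t s st.
rewrite leq_eqVlt => /predU1P[-> _|]; first exact: (zP i).2.
rewrite ltnS leq_eqVlt => /predU1P[-> _|ts st']; first exact: (cu_refl hE).
have -> : Num.truncn (ival s * (M i)%:R)%R = (Num.truncn (ival t * (M i)%:R)%R).+1.
  by apply/eqP; rewrite eqn_leq st' ts.
by apply: (cu_sym hE); exact: (zP i).2.
Qed.

End approximate_paths.

(** * Loop-free paths trace arcs *)

Local Open Scope ring_scope.

(** A continuous surjection from a compact space to a Hausdorff space is a
    quotient map. *)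
Lemma compact_quotient (K S T : topologicalType) (f : K -> S) (g : K -> T) :
  compact [set: K] -> hausdorff_space S -> continuous f -> continuous g ->
  (forall s, exists k, f k = s) -> (forall a b, f a = f b -> g a = g b) ->
  exists h : S -> T, continuous h /\ forall k, h (f k) = g k.
Proof.
move=> cK hS cf cg fsurj fg; pose r s := projT1 (cid (fsurj s)).
have rK s : f (r s) = s := projT2 (cid (fsurj s)).
exists (g \o r); split; last by move=> k; apply: fg; rewrite rK.
apply/continuous_closedP => C clC.
rewrite (_ : _ @^-1` C = f @` (g @^-1` C)).
  apply: compact_closed => //; apply: continuous_compact.
    exact: continuous_subspaceT.
  apply: (subclosed_compact _ cK) => //.
  by move/continuous_closedP: cg; apply.
apply/seteqP; split=> [s Cs|_ [k Ck <-]]; first by exists (r s).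
by rewrite /preimage /= (fg _ k).
Qed.

(** A geometric series of the functions [psi k]. It is increasing at every
    pair of points where all the [psi k] are nondecreasing and one of them
    increases. *)
Lemma weighted_sum (R : realType) (S : topologicalType) (psi : nat -> S -> R) :
  (forall k s, 0 <= psi k s <= 1) -> (forall k, continuous (psi k)) ->
  exists phi : S -> R, continuous phi /\
    forall s t, (forall k, psi k s <= psi k t) ->
      phi s <= phi t /\ forall k, psi k s < psi k t -> phi s < phi t.
Proof.
move=> psi01 cpsi.
pose f := fix f n s : R := if n is n'.+1 then f n' s + 2^-1 ^+ n * psi n' s else 0.
have w0 n : 0 < 2^-1 ^+ n :> R by rewrite exprn_gt0 // invr_gt0 ltr0n.
have f_le n m s : (n <= m)%N -> f n s <= f m s.
  move/subnK <-; elim: (m - n)%N => // k IH; apply: (le_trans IH).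
  rewrite addSn /= lerDl; apply: mulr_ge0; first exact: ltW.
  by case/andP: (psi01 (k + n)%N s).
have f_ge n m s : (n <= m)%N -> f m s + 2^-1 ^+ m <= f n s + 2^-1 ^+ n.
  move/subnK <-; elim: (m - n)%N => // k IH; apply: le_trans IH.
  rewrite addSn /= -addrA lerD2l.
  have -> : 2^-1 ^+ (k + n) = 2^-1 ^+ (k + n).+1 * 1 + 2^-1 ^+ (k + n).+1 :> R.
    by rewrite mulr1 exprS; lra.
  rewrite lerD2r; apply: ler_wpM2l; first exact: ltW.
  by case/andP: (psi01 (k + n)%N s).
have f_ub n m s : f m s <= f n s + 2^-1 ^+ n.
  case: (leqP n m) => [/(f_ge _ _ s)|/ltnW /(f_le _ _ s) h].
    by apply: le_trans; rewrite lerDl; exact: ltW.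
  by apply: (le_trans h); rewrite lerDl; exact: ltW.
have cf n : continuous (f n).
  elim: n => [|n IH] s /=; first exact: cvg_cst.
  by apply: cvgD; [exact: IH|apply: cvgM; [exact: cvg_cst|exact: cpsi]].
pose phi s := sup (range (f ^~ s)).
have supf s : has_sup (range (f ^~ s)).
  split; first by exists (f 0%N s), 0%N.
  by exists (f 0%N s + 2^-1 ^+ 0) => _ [m _ <-].
have phi_ge n s : f n s <= phi s by apply: sup_upper_bound => //; exists n.
have phi_le n s : phi s <= f n s + 2^-1 ^+ n.
  by apply: ge_sup; [exists (f 0%N s), 0%N|move=> _ [m _ <-]].
exists phi; split.
  move=> s; apply/cvgrPdist_le => e e0.
  have [n ne] : exists n, 2^-1 ^+ n <= e / 2.
    have := @cvg_expr R 2^-1; rewrite ger0_norm ?invr_ge0 ?ler0n // invf_lt1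
      ?ltr1n // => /(_ isT).
    move/cvgrPdist_le => /(_ (e / 2)); rewrite divr_gt0 // => /(_ isT) [n _ /(_
      n (leqnn n))].
    by rewrite /= sub0r normrN ger0_norm; [move=> h; exists n|exact: ltW].
  have := cf n s => /cvgrPdist_le /(_ (e / 2)); rewrite divr_gt0 // => /(_ isT).
  apply: filterS => t; rewrite !ler_norml => /andP[h1 h2].
  have := phi_ge n s; have := phi_le n s; have := phi_ge n t; have := phi_le n t.
  by move=> *; apply/andP; split; lra.
move=> s t st.
have f_mono n : f n s <= f n t.
  elim: n => //= n IH; apply: lerD => //; apply: ler_wpM2l => //; exact: ltW.
split.
  apply: ge_sup; first by exists (f 0%N s), 0%N.
  by move=> _ [m _ <-]; apply: le_trans (f_mono m) _.
move=> k kst; pose c := 2^-1 ^+ k.+1 * (psi k t - psi k s).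
have c0 : 0 < c by rewrite mulr_gt0 // subr_gt0.
have fc n : (k < n)%N -> f n s + c <= f n t.
  move/subnK <-; elim: (n - k.+1)%N => [|m IH].
    by rewrite add0n /= /c mulrBr; have := f_mono k; lra.
  rewrite addSn /=; set a := 2^-1 ^+ _ * psi _ s; set b := 2^-1 ^+ _ * psi _ t.
  by have : a <= b by [apply: ler_wpM2l => //; exact: ltW]; lra.
suff : phi s + c <= phi t by lra.
rewrite -lerBrDr; apply: ge_sup; first by exists (f 0%N s), 0%N.
move=> _ [n _ <-]; rewrite lerBrDr.
apply: (@le_trans _ _ (f (maxn n k.+1) s + c));
  first by rewrite lerD2r f_le // leq_maxl.
by apply: le_trans (phi_ge (maxn n k.+1) t); apply: fc; rewrite leq_maxr.
Qed.

Lemma set_val_continuous (T : topologicalType) (A : set T) :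
  continuous (set_val : set_type A -> T).
Proof. exact: initial_continuous. Qed.

Lemma continuous_into_set_type (S T : topologicalType) (A : set T)
    (f : S -> set_type A) :
  continuous (set_val \o f) -> continuous f.
Proof. exact: continuous_comp_initial. Qed.

Lemma set_type_hausdorff (T : topologicalType) (A : set T) :
  hausdorff_space T -> hausdorff_space (set_type A).
Proof.
move=> hT p q pq; apply: val_inj; apply: hT => V W Vp Wq.
have [r [Vr Wr]] := pq _ _ (set_val_continuous Vp) (set_val_continuous Wq).
by exists (set_val r).
Qed.

Lemma continuous_distP (R : realType) (S : topologicalType) (phi : S -> R) s :
  {for s, continuous phi} <->
  forall e : R, 0 < e -> nbhs s [set t | `|phi s - phi t| <= e].
Proof. by split=> [/cvgrPdist_le//|h]; apply/cvgrPdist_le. Qed.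

Section unit_interval.
Variable R : realType.
Local Notation I := (unit_interval R).

Lemma ival_inj : injective (@ival R).
Proof. by move=> s t; rewrite /ival set_valE => /val_inj. Qed.

Lemma ival_continuous : continuous (@ival R).
Proof. exact: set_val_continuous. Qed.

Lemma clamp_subproof (r : R) : Num.min (Num.max r 0) 1 \in `[0 : R, 1]%classic.
Proof.
by apply/mem_set; rewrite /= in_itv /= ge_min lexx orbT le_min ler01 le_max
  lexx orbT.
Qed.

Definition clamp (r : R) : I :=
  exist _ (Num.min (Num.max r 0) 1) (clamp_subproof r).

Lemma clampK (r : R) : 0 <= r <= 1 -> ival (clamp r) = r.
Proof. by move=> /andP[r0 r1]; rewrite /ival set_valE /= max_l // min_l. Qed.

Lemma clamp_ival (t : I) : clamp (ival t) = t.
Proof.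
apply: val_inj; have := @clampK (ival t).
by rewrite ival_ge0 ival_le1 /ival set_valE => /(_ isT).
Qed.

Lemma clamp_continuous : continuous clamp.
Proof.
apply: continuous_into_set_type => r.
apply: (@continuous_min R R (fun r : R => Num.max r 0) (fun=> 1));
  last exact: cvg_cst.
by apply: (@continuous_max R R id (fun=> 0)); [exact: cvg_id|exact: cvg_cst].
Qed.

Lemma unit_interval_compact : compact [set: I].
Proof.
rewrite (_ : setT = clamp @` `[0, 1]).
  apply: continuous_compact; last exact: segment_compact.
  exact/continuous_subspaceT/clamp_continuous.
apply/seteqP; split=> // t _; exists (ival t); last exact: clamp_ival.
by rewrite /= in_itv /= ival_ge0 ival_le1.
Qed.

Lemma unit_interval_hausdorff : hausdorff_space I.
Proof. exact/set_type_hausdorff/Rhausdorff. Qed.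

Lemma unit_interval_nbhs (t : I) (V : set I) : nbhs t V ->
  exists2 e : R, 0 < e & forall s : I, `|ival t - ival s| < e -> V s.
Proof.
move=> [_ [[W oW <-] Wt WV]].
have /nbhs_ballP [e e0 eW] : nbhs (ival t) W by exact: open_nbhs_nbhs.
by exists e => // s ts; apply/WV/eW.
Qed.

Lemma unit_interval_surj (phi : I -> R) (v : R) : continuous phi ->
  phi (unit_interval0 R) <= v <= phi (unit_interval1 R) -> exists t, phi t = v.
Proof.
move=> cphi /andP[v0 v1].
have c0 : clamp 0 = unit_interval0 R by apply: val_inj; rewrite /= max_l // min_l.
have c1 : clamp 1 = unit_interval1 R by apply: val_inj; rewrite /= max_l // min_l.
have [c _ <-] : exists2 c : R, c \in `[0, 1] & (phi \o clamp) c = v.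
  apply: IVT => //.
    apply: continuous_subspaceT => r; apply: continuous_comp.
      exact: clamp_continuous.
    exact: cphi.
  by rewrite /= c0 c1 ge_min le_max v0 v1 orbT.
by exists (clamp c).
Qed.

Definition rational_point (n : nat) : I :=
  clamp (ratr (odflt 0 (unpickle n : option rat))).

Lemma rational_point_dense (s t : I) : ival s < ival t ->
  exists n, ival s < ival (rational_point n) < ival t.
Proof.
move=> /rat_in_itvoo [q]; rewrite in_itv /= => /andP[sq qt].
exists (pickle q); rewrite /rational_point pickleK /= clampK ?sq ?qt //.
by rewrite (le_trans (ival_ge0 s) (ltW sq)) (le_trans (ltW qt) (ival_le1 t)).
Qed.

Lemma rational_point_open (V : set I) (t : I) : open V -> V t ->
  exists n, V (rational_point n).
Proof.
move=> oV Vt; have [e e0 eV] := unit_interval_nbhs (open_nbhs_nbhs (conj oV Vt)).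
have : Num.max 0 (ival t - e) < Num.min 1 (ival t + e).
  have := ival_ge0 t; have := ival_le1 t.
  by rewrite lt_min !gt_max; move=> *; apply/andP; split; apply/andP; split; lra.
move=> /rat_in_itvoo [q]; rewrite in_itv /= gt_max lt_min.
move=> /andP[/andP[q0 tq] /andP[q1 qt]].
exists (pickle q); apply: eV; rewrite /rational_point pickleK /=.
by rewrite clampK ?(ltW q0) ?(ltW q1) // ltr_norml; apply/andP; split; lra.
Qed.

Lemma rational_point_right (V : set I) (s t : I) : open V -> V s ->
  ival s < ival t ->
  exists n, [/\ ival s < ival (rational_point n),
    ival (rational_point n) < ival t & V (rational_point n)].
Proof.
move=> oV Vs st; have [e e0 eV] := unit_interval_nbhs (open_nbhs_nbhs (conj oV Vs)).
have := @rational_point_dense s (clamp (Num.min (ival t) (ival s + e))).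
rewrite clampK; last first.
  have := ival_le1 t; have := ival_ge0 s; rewrite le_min ge_min => s0 t1.
  by apply/andP; split; [apply/andP; split; lra|rewrite t1].
have se : ival s < Num.min (ival t) (ival s + e) by rewrite lt_min st; lra.
move=> /(_ se) [n]; rewrite [X in _ && X]lt_min => /andP[sn /andP[nt ne]].
exists n; split => //.
by apply: eV; rewrite ltr_norml; apply/andP; split; lra.
Qed.

Section running_oscillation.
Variable g : I -> R.
Hypothesis g01 : forall t, 0 <= g t <= 1.

(** As a function of [t] this is nondecreasing, and constant wherever [g] is. It
    vanishes before the time [c]; hence, for [c] between [s] and [t], it tells
    [s] from [t] as soon as [g] differs at [c] and [t]. *)
Definition running_osc (c t : I) : R :=
  sup [set r : R | r = 0 \/ exists u : I,
    [/\ ival c <= ival u, ival u <= ival t & r = `|g u - g c| ] ].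

Let osc_set_le1 (c t : I) : ubound [set r : R | r = 0 \/ exists u : I,
  [/\ ival c <= ival u, ival u <= ival t & r = `|g u - g c| ] ] 1.
Proof.
move=> r [->|[u [_ _ ->]]]; first exact: ler01.
have /andP[u0 u1] := g01 u; have /andP[c0 c1] := g01 c.
by rewrite ler_norml; apply/andP; split; lra.
Qed.

Let running_osc_ub (c t : I) (r : R) : (r = 0 \/ exists u : I,
  [/\ ival c <= ival u, ival u <= ival t & r = `|g u - g c| ]) ->
  r <= running_osc c t.
Proof.
move=> h; apply: sup_upper_bound => //; split; first by exists 0; left.
by exists 1; exact: osc_set_le1.
Qed.

Lemma running_osc01 (c t : I) : 0 <= running_osc c t <= 1.
Proof.
apply/andP; split; first by apply: running_osc_ub; left.
by apply: ge_sup; [exists 0; left|exact: osc_set_le1].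
Qed.

Lemma running_osc_mono (c s t : I) : ival s <= ival t ->
  running_osc c s <= running_osc c t.
Proof.
move=> st; apply: ge_sup; first by exists 0; left.
move=> r [->|[u [cu us ->]]]; apply: running_osc_ub; first by left.
by right; exists u; split=> //; exact: le_trans st.
Qed.

(** With [e] small this gives continuity, and with [e = 0] constancy on the
    intervals where [g] is constant. *)
Lemma running_osc_le (c s t : I) (e : R) : 0 <= e ->
  (forall u v : I, ival s <= ival u <= ival t ->
    ival s <= ival v <= ival t -> `|g u - g v| <= e) ->
  running_osc c t <= running_osc c s + e.
Proof.
move=> e0 he; have /andP[ osc0 _] := running_osc01 c s.
apply: ge_sup; first by exists 0; left.
move=> r [->|[u [cu ut ->]]]; first by rewrite addr_ge0.
have [us|su] := leP (ival u) (ival s).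
  by apply: ler_wpDr => //; apply: running_osc_ub; right; exists u.
have [cs|sc] := leP (ival c) (ival s).
  have : `|g s - g c| <= running_osc c s.
    by apply: running_osc_ub; right; exists s.
  have : `|g u - g s| <= e by apply: he; rewrite ?lexx ?(ltW su) ?ut //
    (le_trans (ltW su)).
  have := ler_normD (g u - g s) (g s - g c); rewrite addrA subrK; lra.
have : `|g u - g c| <= e by apply: he; rewrite ?(ltW su) ?ut ?(ltW sc) //
  (le_trans cu).
lra.
Qed.

Lemma running_osc_continuous (c : I) : continuous g -> continuous (running_osc c).
Proof.
move=> cg s; apply/continuous_distP => e e0.
have e2 : 0 < e / 2 by rewrite divr_gt0.
have /continuous_distP /(_ _ e2) /unit_interval_nbhs [d d0 hd] := cg s.
have near_osc (a b : I) : `|ival s - ival a| < d -> `|ival s - ival b| < d ->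
    running_osc c b <= running_osc c a + e.
  move=> sa sb.
  apply: running_osc_le; first exact: ltW.
  move=> u v /andP[au ub] /andP[av vb].
  have su : `|ival s - ival u| < d.
    by move: sa sb; rewrite !ltr_norml => /andP[? ?] /andP[? ?]; apply/andP;
      split; lra.
  have sv : `|ival s - ival v| < d.
    by move: sa sb; rewrite !ltr_norml => /andP[? ?] /andP[? ?]; apply/andP;
      split; lra.
  have := hd u su; have := hd v sv => /=.
  by rewrite !ler_norml => /andP[? ?] /andP[? ?]; apply/andP; split; lra.
have ss : `|ival s - ival s| < d by rewrite subrr normr0.
have : nbhs s [set t : I | `|ival s - ival t| < d].
  have d2 : 0 < d / 2 by rewrite divr_gt0.
  have /continuous_distP /(_ _ d2) := @ival_continuous s.
  by apply: filterS => t /= sd; apply: (le_lt_trans sd); lra.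
apply: filterS => t st; rewrite /= ler_norml; apply/andP; split.
  by have := near_osc s t ss st; lra.
by have := near_osc t s st ss; lra.
Qed.

Lemma running_osc_lt (c s t : I) : ival s < ival c < ival t ->
  g c != g t -> running_osc c s < running_osc c t.
Proof.
move=> /andP[sc ct] gct; apply: (@le_lt_trans _ _ 0).
  apply: ge_sup; first by exists 0; left.
  by move=> r [->//|[u [cu us _]]]; have := le_trans cu us; lra.
apply: (@lt_le_trans _ _ `|g t - g c|); first by rewrite normr_gt0 subr_eq0 eq_sym.
by apply: running_osc_ub; right; exists t; split=> //; exact: ltW.
Qed.

End running_oscillation.

Definition loop_free (T : Type) (g : I -> T) := forall s t u : I,
  g s = g t -> ival s <= ival u <= ival t -> g u = g s.

(** The running oscillations of the coordinates of [g], started at all rational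
    times, add up to a continuous monotone function with the same fibres as
    [g]. After rescaling it maps onto the unit interval, so that the interval
    and the image of [g] are the same quotient of the interval. *)
Lemma loop_free_arc (T : topologicalType) (f : nat -> T -> R) (g : I -> T) :
  hausdorff_space T -> (forall i, continuous (f i)) ->
  (forall i p, 0 <= f i p <= 1) ->
  (forall p q, (forall i, f i p = f i q) -> p = q) ->
  continuous g -> loop_free g ->
  g (unit_interval0 R) <> g (unit_interval1 R) ->
  arc_with_endpoints R (range g) (g (unit_interval0 R)) (g (unit_interval1 R)).
Proof.
move=> hT cf f01 fsep cg lg g01.
pose psi k t := let ij := odflt (0, 0)%N (unpickle k : option (nat * nat)) in
  running_osc (f ij.1 \o g) (rational_point ij.2) t.
have fg01 i t : 0 <= (f i \o g) t <= 1 by exact: f01.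
have [||phi [cphi phiP]] := @weighted_sum R _ psi.
- by move=> k t; exact: running_osc01.
- move=> k; apply: running_osc_continuous => // t; apply: continuous_comp;
  [exact: cg|exact: cf].
have psi_mono (s t : I) : ival s <= ival t -> forall k, psi k s <= psi k t.
  by move=> st k; exact: running_osc_mono.
have phi_eq (s t : I) : ival s <= ival t -> g s = g t -> phi s = phi t.
  move=> st gst; apply/eqP; rewrite eq_le (phiP _ _ (psi_mono _ _ st)).1 /=.
  apply: (phiP t s _).1 => k; rewrite -[leRHS]addr0;
    apply: running_osc_le => // u v su sv.
  by rewrite /= (lg s t u) // (lg s t v) // subrr normr0.
have phi_lt (s t : I) : ival s <= ival t -> g s <> g t -> phi s < phi t.
  move=> st gst; pose V := ~` (g @^-1` [set g t]).
  have oV : open V.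
    apply: closed_openC; apply: preimage_closed => [x _|]; first exact: cg.
    exact/accessible_closed_set1/hausdorff_accessible.
  have st' : ival s < ival t.
    rewrite lt_neqAle st andbT; apply/eqP => /ival_inj E.
    by apply: gst; rewrite E.
  have [n [sn nt gn]] := rational_point_right oV gst st'.
  have [i /eqP fi] : exists i, f i (g (rational_point n)) <> f i (g t).
    by apply: contrapT => H; apply/gn/fsep => i; apply: contrapT => Hi;
      apply: H; exists i.
  apply: (phiP s t (psi_mono _ _ st)).2 (pickle (i, n)) _.
  by rewrite /psi pickleK /=; apply: running_osc_lt => //; rewrite sn nt.
have phi_mono (s t : I) : ival s <= ival t -> phi s <= phi t.
  by move=> st; exact: (phiP _ _ (psi_mono _ _ st)).1.
have fib (s t : I) : phi s = phi t <-> g s = g t.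
  wlog st : s t / ival s <= ival t.
    move=> H; case: (leP (ival s) (ival t)) => [/H//|/ltW/H [h1 h2]].
    by split=> E; apply/esym; [apply: h1|apply: h2].
  split=> [pst|]; last exact: phi_eq.
  by apply: contrapT => /(phi_lt _ _ st); rewrite pst ltxx.
pose a := phi (unit_interval0 R); pose b := phi (unit_interval1 R).
have ival0 : ival (unit_interval0 R) = 0 by rewrite /ival set_valE.
have ival1 : ival (unit_interval1 R) = 1 by rewrite /ival set_valE.
have ab : 0 < b - a by rewrite subr_gt0; apply: phi_lt => //; rewrite ival0 ival1.
pose Phi t := clamp ((phi t - a) / (b - a)).
have PhiE t : ival (Phi t) = (phi t - a) / (b - a).
  apply: clampK; apply/andP; split.
    apply: divr_ge0; last exact: ltW.
    by rewrite subr_ge0; apply: phi_mono; rewrite ival0 ival_ge0.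
  rewrite ler_pdivrMr // mul1r lerD2r.
  by apply: phi_mono; rewrite ival1 ival_le1.
have cPhi : continuous Phi.
  pose f1 : I -> R := fun t => phi t - a.
  have c1 : continuous f1.
    by move=> t; apply: continuousB; [exact: cphi|exact: cst_continuous].
  pose f2 : I -> R := fun t => f1 t * (b - a)^-1.
  have c2 : continuous f2.
    by move=> t; apply: (cvgM (c1 t)); exact: cvg_cst.
  move=> t; apply: continuous_comp; first exact: c2.
  exact: clamp_continuous.
have Phi_fib s t : Phi s = Phi t <-> g s = g t.
  rewrite -fib; split=> [/(congr1 (@ival R))|E]; last by rewrite /Phi E.
  by rewrite !PhiE => /(mulIf (invr_neq0 (lt0r_neq0 ab))) /addIr.
have Phi_surj u : exists t, Phi t = u.
  have [t tu] : exists t, phi t = a + ival u * (b - a).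
    apply: unit_interval_surj => //; rewrite -/a -/b.
    have := ival_ge0 u; have := ival_le1 u => u1 u0.
    have : 0 <= ival u * (b - a) by rewrite mulr_ge0 // ltW.
    have : ival u * (b - a) <= b - a by rewrite ler_piMl // ltW.
    by move=> *; apply/andP; split; lra.
  exists t; apply: ival_inj.
  by rewrite PhiE tu addrAC subrr add0r mulfK // gt_eqF.
have gP t : g t \in range g by apply/mem_set; exists t.
pose g' t : set_type (range g) := exist _ (g t) (gP t).
have cg' : continuous g' by apply: continuous_into_set_type; rewrite /comp set_valE.
have g'_inj s t : g' s = g' t <-> g s = g t.
  by split=> [/(congr1 val)//|E]; apply: val_inj.
have g'_surj p : exists t, g' t = p.
  case: p => p pP; have [t _ tp] := set_mem pP.
  by exists t; apply: val_inj.
have [|h [ch hP]] := compact_quotient unit_interval_compact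
  unit_interval_hausdorff cPhi cg' Phi_surj.
  by move=> s t /Phi_fib /g'_inj.
have [|k [ck kP]] := compact_quotient unit_interval_compact (set_type_hausdorff
  hT) cg' cPhi g'_surj.
  by move=> s t /g'_inj /Phi_fib.
have Phi0 : Phi (unit_interval0 R) = unit_interval0 R.
  by apply: ival_inj; rewrite PhiE subrr mul0r ival0.
have Phi1 : Phi (unit_interval1 R) = unit_interval1 R.
  by apply: ival_inj; rewrite PhiE mulfV ?ival1 // gt_eqF.
exists h; split.
- split=> //; exists k; split=> [u|p|//].
    by have [t <-] := Phi_surj u; rewrite hP kP.
  by have [t <-] := g'_surj p; rewrite kP hP.
- by have := hP (unit_interval0 R); rewrite Phi0 => ->; rewrite set_valE.
- by have := hP (unit_interval1 R); rewrite Phi1 => ->; rewrite set_valE.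
Qed.


End unit_interval.

(** * The Vietoris topology *)

Section hyperspace_topology.
Import finmap.
Variable T : topologicalType.

Lemma vietoris_subbase_open (A : set (hyperspace T)) :
  vietoris_subbase A -> open A.
Proof.
move=> sA.
suff : finI_from (@vietoris_subbase T) id A.
  by move=> fA; pose F := [set A]; exists F; [move=> _ ->|rewrite bigcup_set1].
exists [fset A]%fset => /=.
  by move=> B /fset1P ->; exact/mem_set.
by apply/seteqP; split=> [K AK|K AK B]; [exact: (AK A (fset11 A))|move=>
  /fset1P ->].
Qed.

Lemma open_contained (U : set T) : open U -> open [set K : hyperspace T | K `<=` U].
Proof. by move=> oU; apply: vietoris_subbase_open; left; exists U. Qed.

Lemma open_hitting (U : set T) : open U -> open [set K : hyperspace T | K `&` U
  !=set0].
Proof. by move=> oU; apply: vietoris_subbase_open; right; exists U. Qed.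

Variables (E : nat -> T -> T -> Prop) (N : nat -> nat).
Variable O : forall l, 'I_(N l) -> set T.
Hypotheses (hE : closed_uniformity E) (cT : compact [set: T]).
Hypothesis hO : pixels E O.

Lemma hyperspace_mem_closed :
  closed [set Kp : hyperspace T * T | hyperspace_set Kp.1 Kp.2].
Proof.
rewrite -[X in closed X]setCK; apply: open_closedC; rewrite openE => -[K p] /= nKp.
have clp : closed [set p].
  exact/accessible_closed_set1/hausdorff_accessible/(cu_hausdorff hE).
have [|n nP] := compact_uniform_nbhs hE cT (@hyperspace_compact _ K)
  (closed_openC clp).
  by move=> q Kq /= qp; apply: nKp; rewrite -qp.
exists ([set K' : hyperspace T | K' `<=` ~` (E n p)], E n p).
  split => /=; last exact: (cu_nbhs hE).
  apply: open_nbhs_nbhs; split; first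
    exact/open_contained/closed_openC/(cu_closed_at hE).
  by move=> q Kq pq; apply: (nP q p Kq); [exact: (cu_sym hE)|].
by move=> [K' q] /= [K'p pq] K'q; exact: (K'p q).
Qed.

(** Two compact sets that hit the same pixels at a fine level are close in the
    Hausdorff sense, so the classes of compact sets with given pixels form a
    countable network of the hyperspace. *)
Lemma vietoris_pixels (U : set (hyperspace T)) (K : hyperspace T) :
  open U -> U K ->
  exists l, forall K' : hyperspace T, hit O l K' = hit O l K -> U K'.
Proof.
move=> [D' sD' <-] [B D'B BK]; have [F sF FB] := sD' _ D'B.
have near_hit (A : set (hyperspace T)) : A \in F -> \forall l \near \oo,
    forall K' : hyperspace T, hit O l K' = hit O l K -> A K'.
  move=> AF; have AK : A K by move: BK; rewrite -FB; exact.
  case: (set_mem (sF _ AF)) => [[V oV AE]|[V oV AE]]; rewrite -{}AE in AK *.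
    have [n nV] := compact_uniform_nbhs hE cT (@hyperspace_compact _ K) oV AK.
    exists n => // l /= nl K' KK' q K'q; have [i iq] := pixel_cover hO l q.
    have /hitP [p [Kp ip]] : i \in hit O l K by rewrite -KK'; apply/hitP; exists q.
    exact/(nV p q Kp)/(cu_mono hE nl)/(pixel_small hO ip iq).
  have [p [Kp Vp]] := AK.
  have [n nV] := cu_base hE cT (open_nbhs_nbhs (conj oV Vp)).
  exists n => // l /= nl K' KK'; have [i ip] := pixel_cover hO l p.
  have /hitP [q [K'q iq]] : i \in hit O l K' by rewrite KK'; apply/hitP; exists p.
  by exists q; split=> //; apply/nV/(cu_mono hE nl)/(pixel_small hO ip iq).
have := @filter_bigI _ _ F _ _ _ near_hit => -[l _ /(_ l (leqnn l)) H].
exists l => K' KK'; suff BK' : B K' by exists B.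
by rewrite -FB => A AF; exact: H.
Qed.

End hyperspace_topology.

Lemma closed_compact_projection (D Z : topologicalType) (W : set (D * Z)) :
  compact [set: Z] -> closed W -> closed [set d | exists z, W (d, z)].
Proof.
move=> cZ clW; rewrite -[X in closed X]setCK; apply: open_closedC.
rewrite openE => d nW.
have near_compl z : [set: Z] z ->
    \forall z' \near z & d' \near nbhs d, ~ W (d', z').
  move=> _; have : nbhs (d, z) (~` W).
    apply: open_nbhs_nbhs; split; first exact: closed_openC.
    by move=> Wdz; apply: nW; exists z.
  move=> [[P Q] [Pd Qz] PQ]; exists (Q, P) => // -[z' d'] [/= Qz' Pd'].
  exact: (PQ (d', z')).
have /compact_near_coveringP cvZ := cZ.
have := cvZ D (nbhs d) (fun d z => ~ W (d, z)) (nbhs_filter d) near_compl.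
by apply: filterS => d' H [z Wz]; exact: (H z).
Qed.

(** * The space of paths *)

Lemma pair_continuous (S T U : topologicalType) (f : S -> T) (g : S -> U) :
  continuous f -> continuous g -> continuous (fun s => (f s, g s)).
Proof.
move=> cf cg s W [[P Q] [/= fP gQ] PQ].
have fP' : nbhs s (f @^-1` P) := cf s P fP.
have gQ' : nbhs s (g @^-1` Q) := cg s Q gQ.
by apply: filterS (filterI fP' gQ') => x [Px Qx]; exact: PQ.
Qed.

Lemma comp_continuous (S T U : topologicalType) (f : S -> T) (g : T -> U) :
  continuous f -> continuous g -> continuous (fun s => g (f s)).
Proof. by move=> cf cg s; apply: continuous_comp; [exact: cf|exact: cg]. Qed.

Section path_space.
Variables (R : realType) (T : topologicalType) (E : nat -> T -> T -> Prop).
Hypotheses (hE : closed_uniformity E) (cT : compact [set: T]).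
Local Notation I := (unit_interval R).
Local Notation Z := {ptws I -> T}.

Lemma path_space_compact : compact [set: Z].
Proof.
have := @tychonoff I (fun=> T) (fun=> setT) (fun=> cT).
by congr compact; apply/seteqP; split.
Qed.

Lemma path_eval_continuous (t : I) : continuous (fun z : Z => z t).
Proof. exact: (@proj_continuous I (fun=> T) t). Qed.

Lemma closed_related n (s t : I) : closed [set z : Z | E n (z s) (z t)].
Proof.
have -> : [set z : Z | E n (z s) (z t)] =
  (fun z : Z => (z s, z t)) @^-1` [set pq : T * T | E n pq.1 pq.2] by [].
apply: preimage_closed; last exact: cu_closed.
by move=> z _; apply: pair_continuous; exact: path_eval_continuous.
Qed.

Lemma closed_relatedP n (P : I -> I -> Prop) :
  closed [set z : Z | forall s t, P s t -> E n (z s) (z t)].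
Proof.
rewrite (_ : [set z : Z | _] = \bigcap_(st in [set st : I * I | P st.1 st.2])
    [set z : Z | E n (z st.1) (z st.2)]).
  by apply: closed_bigI => st _; exact: closed_related.
by apply/seteqP; split=> z h; [move=> [s t] /=; exact: h|move=> s t Pst;
  exact: (h (s, t))].
Qed.

Lemma modulus_continuous (a : nat -> nat) (z : I -> T) :
  (forall i, modulus E i (a i) z) -> continuous z.
Proof.
move=> za s U /(cu_base hE cT) [n nU].
have : nbhs s [set t : I | `|ival s - ival t| <= (a (n + 5)%N).+1%:R^-1].
  have /continuous_distP := @ival_continuous R s; apply.
  by rewrite invr_gt0 ltr0n.
apply: filterS => t /= st; apply: nU; have := za (n + 5)%N s t.
rewrite addnK; apply; apply: le_trans (_ : (a (n + 5)%N).+1%:R^-1 * (a (n +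
  5)%N)%:R <= 1).
  by rewrite ler_wpM2r.
by rewrite mulrC ler_pdivrMr ?ltr0n // mul1r ler_nat.
Qed.

(** When [z s = z t], the path rests between [s] and [t] instead of making an
    excursion. *)
Definition cut_path (z : I -> T) (s t : I) : I -> T :=
  fun v => if ival s <= ival v <= ival t then z s else z v.

(** A path with a rest takes, at the ends of any interval, either equal values
    or two values that the original path takes in this interval. So every
    condition that bounds oscillations on intervals is inherited. *)
Lemma cutP (z : I -> T) (s t v w : I) : z s = z t -> ival v <= ival w ->
  cut_path z s t v = cut_path z s t w \/ exists v' w', [/\ cut_path z s t v = z v',
    cut_path z s t w = z w', ival v <= ival v' <= ival w & ival v <= ival w' <=
      ival w].
Proof.
move=> zst vw; rewrite /cut_path.
case: ifPn => [/andP[sv vt]|nv]; case: ifPn => [/andP[sw wt]|nw].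
- by left.
- right; exists t, w; rewrite vw lexx vt; split=> //.
  by move: nw; rewrite (le_trans sv vw) /= -ltNge => /ltW ->.
- right; exists v, s; rewrite vw lexx sw; split=> //.
  by move: nv; rewrite (le_trans vw wt) andbT -ltNge => /ltW ->.
- by right; exists v, w; rewrite vw !lexx.
Qed.

Lemma cut_related (z : I -> T) (s t : I) n (P : I -> I -> Prop) :
  z s = z t -> (forall v w, P v w -> P w v) ->
  (forall v w v' w', P v w -> ival v <= ival w ->
    ival v <= ival v' <= ival w -> ival v <= ival w' <= ival w -> P v' w') ->
  (forall v w, P v w -> E n (z v) (z w)) ->
  forall v w, P v w -> E n (cut_path z s t v) (cut_path z s t w).
Proof.
move=> zst symP monoP Pz v w; wlog vw : v w / ival v <= ival w.
  move=> H Pvw; case: (leP (ival v) (ival w)) => [|/ltW] h; first exact: H.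
  by apply: (cu_sym hE); apply: H => //; exact: symP.
move=> Pvw; have [->|[v' [w' [-> -> hv hw]]]] := cutP zst vw;
  first exact: (cu_refl hE).
exact/Pz/(monoP v w).
Qed.

Lemma cut_modulus (z : I -> T) (s t : I) i a :
  z s = z t -> modulus E i a z -> modulus E i a (cut_path z s t).
Proof.
move=> zst zm v w; move: v w.
apply: (cut_related (P := fun v w => `|ival v - ival w| * a%:R <= 1)) => //.
  by move=> v w; rewrite distrC.
move=> v w v' w' Pvw vw /andP[h1 h2] /andP[h3 h4]; apply: le_trans Pvw.
rewrite ler_wpM2r // [X in _ <= X]distrC [X in _ <= X]ger0_norm ?subr_ge0 //.
by rewrite ler_norml; apply/andP; split; lra.
Qed.

End path_space.

(** * The Borel choice of an arc *)

Section selection.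
Variables (R : realType) (T : topologicalType) (E : nat -> T -> T -> Prop).
Variables (N : nat -> nat) (O : forall l, 'I_(N l) -> set T).
Hypotheses (hE : closed_uniformity E) (cT : compact [set: T]) (hO : pixels E O).
Variables (D : topologicalType) (X : D -> hyperspace T) (x y : D -> T).
Hypotheses (cX : continuous X) (cx : continuous x) (cy : continuous y).
Hypotheses (Xx : forall d, hyperspace_set (X d) (x d)).
Hypotheses (Xy : forall d, hyperspace_set (X d) (y d)).
Hypothesis connX : forall d, connected (X d).
Hypothesis lcX : forall d p U, hyperspace_set (X d) p -> nbhs p U ->
  exists V W, [/\ V `<=` X d `&` U, connected V, nbhs p W & X d `&` W `<=` V].

Local Notation I := (unit_interval R).
Local Notation Z := {ptws I -> T}.
Local Notation B := (<<s @open D >>).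

Let sB : sigma_algebra setT B := smallest_sigma_algebra setT (@open D).

Let openB (A : set D) : open A -> B A.
Proof. exact: sub_sigma_algebra. Qed.

Let nat_comp (a b : D -> nat) (h : nat -> nat -> nat) :
  (forall k, B [set d | a d = k]) -> (forall k, B [set d | b d = k]) ->
  forall k, B [set d | h (a d) (b d) = k].
Proof.
move=> ma mb k; rewrite [X in B X](_ : _ =
    [set d | exists ij : nat * nat, (a d = ij.1 /\ b d = ij.2) /\ h ij.1 ij.2 = k]).
  apply: (sig_bigcup sB) => ij; apply: (sigI sB); last exact: sig_cst.
  exact: (sigI sB (ma ij.1) (mb ij.2)).
apply/seteqP; split=> d /=; first by exists (a d, b d).
by move=> [[i j] /= [[-> ->]]].
Qed.

(** The requirement [n <= k] makes the steps of the chain of level [n] at most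
    [n]-large. *)
Let good d n k := (n <= k)%N && `[< connected_scale E O (X d) n k >].

Let good_exists d n : exists k, good d n k.
Proof.
have [k kP] := connected_scale_exists hE cT hO n (@hyperspace_compact _ (X d))
  (@lcX d).
exists (maxn n k); rewrite /good leq_maxl asboolT //.
exact: (connected_scale_mono hE (leq_maxr n k) kP).
Qed.

Let kappa d n := ex_minn (good_exists d n).

Let kappaP d n : (n <= kappa d n)%N /\ connected_scale E O (X d) n (kappa d n).
Proof. by rewrite /kappa; case: ex_minnP => k /andP[nk /asboolP]. Qed.

Let kappa0 d : kappa d 0%N = 0%N.
Proof.
rewrite /kappa; case: ex_minnP => k _ /(_ 0%N).
by rewrite leqn0 /good leqnn asboolT => [/(_ isT)/eqP|];
  last exact: connected_scale0.
Qed.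

Let good_measurable n k : B [set d | good d n k].
Proof.
rewrite [X in B X](_ : _ = [set d | (n <= k)%N /\ connected_scale E O (X d) n k]).
  apply: (sigI sB); first exact: sig_cst.
  apply: (@connected_scale_measurable _ E _ O _ B (fun d => X d) n k sB) => l
    i; apply: openB.
  move/continuousP: cX => /(_ _ (open_hitting (pixel_open hO i))); exact.
by apply/seteqP; split=> d /=; rewrite /good;
  [move/andP => [? /asboolP]|move=> [-> /asboolP]].
Qed.

Let kappa_measurable n k : B [set d | kappa d n = k].
Proof.
rewrite [X in B X](_ : _ = [set d | good d n k /\ forall j, ~ (good d n j /\ (j
  < k)%N)]).
  have mj j : B [set d | good d n j /\ (j < k)%N].
    exact: (sigI sB (good_measurable n j) (sig_cst sB _)).
  exact: (sigI sB (good_measurable n k) (sig_bigcap sB (fun j => sigC sB (mj j)))).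
apply/seteqP; split=> d /=; rewrite /kappa; case: ex_minnP => m gm mmin.
  by move=> <-; split=> // j [/mmin mj]; rewrite ltnNge mj.
move=> [gk kmin]; apply/eqP; rewrite eqn_leq mmin //= leqNgt; apply/negP => mk.
exact: (kmin m).
Qed.

Let cells_measurable n k : B [set d | cells N (kappa d) n = k].
Proof.
elim: n k => [|n IH] k /=; first exact: sig_cst.
apply: (@nat_comp _ _ muln) => //.
exact: (@nat_comp _ _ (fun i j => N (i + j).+1)).
Qed.

Let base d : set Z := [set z | [/\ z (unit_interval0 R) = x d,
  z (unit_interval1 R) = y d & forall t, hyperspace_set (X d) (z t)]].

(** The equations at the endpoints are written with the entourages because the
    diagonal is the intersection of these closed sets. *)
Let base_graph_closed : closed [set dz : D * Z | base dz.1 dz.2].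
Proof.
rewrite (_ : [set dz : D * Z | _] = (\bigcap_n [set dz : D * Z | E n (dz.2
  (unit_interval0 R)) (x dz.1)])
   `&` (\bigcap_n [set dz : D * Z | E n (dz.2 (unit_interval1 R)) (y dz.1)])
   `&` (\bigcap_t [set dz : D * Z | hyperspace_set (X dz.1) (dz.2 t)])).
  have c2 t : continuous (fun dz : D * Z => dz.2 t).
    by apply: (@comp_continuous _ Z T snd (fun z : Z => z t));
      [move=> dz; exact: cvg_snd|exact: path_eval_continuous].
  have c1 (U : topologicalType) (h : D -> U) : continuous h -> continuous (fun
    dz : D * Z => h dz.1).
    by move=> ch; apply: (@comp_continuous _ D U fst h); [move=> dz;
      exact: cvg_fst|].
  have cE n t (h : D -> T) : continuous h -> closed [set dz : D * Z | E n (dz.2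
    t) (h dz.1)].
    move=> ch; have := @cu_closed _ _ hE n.
    have /continuous_closedP := pair_continuous (c2 t) (c1 _ _ ch).
    by move=> H /H.
  apply: closedI; first apply: closedI.
  - by apply: closed_bigI => n _; exact: cE.
  - by apply: closed_bigI => n _; exact: cE.
  apply: closed_bigI => t _.
  have := hyperspace_mem_closed hE cT.
  have /continuous_closedP := pair_continuous (c1 _ _ cX) (c2 t).
  by move=> H /H.
apply/seteqP; split=> [[d z] /= [z0 z1 zX]|[d z] /= [[z0 z1] zX]].
  split; first split.
  - by move=> n _ /=; rewrite z0; exact: (cu_refl hE).
  - by move=> n _ /=; rewrite z1; exact: (cu_refl hE).
  - by move=> t _; exact: zX.
split=> [||t]; last exact: zX.
- by apply: (cu_sep hE) => n; exact: z0.
- by apply: (cu_sep hE) => n; exact: z1.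
Qed.

Let base_measurable : hits_measurable B base.
Proof.
move=> C clC; rewrite [X in B X](_ : _ = ~` ~` [set d | exists z, base d z /\ C
  z]); last by rewrite setCK.
apply: (sigC sB); apply: openB; apply: closed_openC.
apply: (@closed_compact_projection D Z [set dz : D * Z | base dz.1 dz.2 /\ C dz.2]).
  exact: path_space_compact.
apply: closedI; first exact: base_graph_closed.
have /continuous_closedP : continuous (snd : D * Z -> Z) by move=> dz;
  exact: cvg_snd.
exact.
Qed.

Let base_closed d : closed (base d).
Proof.
have /continuous_closedP : continuous (fun z : Z => (d, z)).
  by apply: pair_continuous; [exact: cst_continuous|move=> z U].
by move=> /(_ _ base_graph_closed).
Qed.

(** The modulus conditions are imposed one at a time: each of them depends on
    the triple through a single natural number. *)
Let staged_paths := fix P n d : set Z := if n is n'.+1 then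
  P n' d `&` (modulus E n' (cells N (kappa d) n') : set Z) else base d.

Let modulus_closed i a : closed (modulus E i a : set Z).
Proof. exact: closed_relatedP. Qed.

Let regular_paths d : set Z := [set z | base d z /\ forall i, modulus E i
  (cells N (kappa d) i) z].

Let staged_pathsE d z : regular_paths d z <-> forall n, staged_paths n d z.
Proof.
split=> [[bz mz] n|H]; first by elim: n => //= n IH; split.
by split=> [|i]; [exact: (H 0%N)|case: (H i.+1)].
Qed.

Let staged_paths_closed n d : closed (staged_paths n d).
Proof. by elim: n => [|n IH] /=; [exact: base_closed|exact: closedI]. Qed.

Let regular_pathsE : regular_paths = fun d => [set z | forall n, staged_paths n
  d z].
Proof. by apply/funext => d; apply/seteqP; split=> z /staged_pathsE. Qed.

Let regular_paths_measurable : hits_measurable B regular_paths.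
Proof.
rewrite regular_pathsE; apply: hits_measurable_nested => //.
- exact: path_space_compact.
- elim=> [|n IH]; first exact: base_measurable.
  exact: (hits_measurable_meet sB (a := fun d => cells N (kappa d) n) (G := fun
    a => modulus E n a : set Z)).
- by move=> n d z [].
Qed.

Let regular_paths_closed d : closed (regular_paths d).
Proof.
rewrite regular_pathsE (_ : [set z | _] = \bigcap_n staged_paths n d);
  first exact: closed_bigI.
by apply/seteqP; split=> z /= H; [move=> n _|move=> n]; exact: H.
Qed.

Let regular_paths_nonempty d : regular_paths d !=set0.
Proof.
have [|||z Hz] := @compact_nested _ (fun n => staged_paths n d)
  (path_space_compact cT).
- by move=> n.
- by move=> n z [].
- move=> n; have [g [g0 g1 gX gm]] := @approximate_path R T E N O hE hO (X d)
  (kappa d) (x d) (y d) (Xx d) (Xy d) (kappa0 d) (kappaP d) n.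
  exists g; elim: {-2}n (leqnn n) => [|k IH] kn //=.
  by split; [exact/IH/ltnW|exact/gm/ltnW].
- by exists z; apply/staged_pathsE.
Qed.

Let regular_paths_continuous d z : regular_paths d z -> continuous z.
Proof. by move=> [_ mz]; exact: (modulus_continuous hE cT mz). Qed.

(** A rest turns some of these conditions from false to true. *)
Let still (k : nat) : set Z := let: (i, j, n) :=
    odflt (0, 0, 0)%N (unpickle k : option (nat * nat * nat)) in
  [set z | forall s t : I,
    (ival (rational_point R i) <= ival s <= ival (rational_point R j)) &&
    (ival (rational_point R i) <= ival t <= ival (rational_point R j)) ->
    E n (z s) (z t)].

Let still_closed k : closed (still k).
Proof. by rewrite /still; case: (odflt _ _) => [[i j] n];
  exact: closed_relatedP. Qed.

Let cut_still z s t k : z s = z t -> still k z -> still k (cut_path z s t).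
Proof.
move=> zst; rewrite /still; case: (odflt _ _) => [[i j] n] zk.
apply: (cut_related hE zst) => //.
  by move=> v w; rewrite andbC.
move=> v w v' w' /andP[/andP[iv vj] /andP[iw wj]] vw /andP[vv' v'w] /andP[vw' w'w].
by apply/andP; split; apply/andP; split; lra.
Qed.

Let cut_regular d z s t : ival s <= ival t -> z s = z t ->
  regular_paths d z -> regular_paths d (cut_path z s t).
Proof.
move=> st zst [[z0 z1 zX] zm]; split; last by move=> i; exact: cut_modulus.
have ival0 : ival (unit_interval0 R) = 0 by rewrite /ival set_valE.
have ival1 : ival (unit_interval1 R) = 1 by rewrite /ival set_valE.
split.
- rewrite /cut_path ival0; case: ifP => // /andP[s0 _].
  rewrite -z0; congr z; apply: ival_inj; apply/eqP.
  by rewrite ival0 eq_le s0 ival_ge0.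
- rewrite /cut_path ival1; case: ifP => // /andP[_ t1].
  rewrite zst -z1; congr z; apply: ival_inj; apply/eqP.
  by rewrite ival1 eq_le t1 ival_le1.
- by move=> v; rewrite /cut_path; case: ifP => _; exact: zX.
Qed.

Let neq_open (z : I -> T) p : continuous z -> open [set v | z v <> p].
Proof.
move=> cz; rewrite (_ : [set v | _] = ~` (z @^-1` [set p])) //.
apply: closed_openC; move/continuous_closedP: cz; apply.
exact/accessible_closed_set1/hausdorff_accessible/(cu_hausdorff hE).
Qed.

(** If the path leaves [z s] between [s] and [t], then there are rational times
    in between at which it takes different values. The stillness condition on
    the interval that they bound holds for the path with a rest only. *)
Let minimal_loop_free d z : regular_paths d z ->
  (forall z', regular_paths d z' -> (forall k, still k z -> still k z') ->
    forall k, still k z' -> still k z) ->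
  loop_free z.
Proof.
move=> rz minz s t u zst /andP[su ut]; apply: contrapT => zus.
have cz := regular_paths_continuous rz.
have st : ival s <= ival t by exact: le_trans ut.
have su' : ival s < ival u.
  by rewrite lt_neqAle su andbT; apply/eqP => /ival_inj E'; apply: zus; rewrite E'.
have ut' : ival u < ival t.
  by rewrite lt_neqAle ut andbT; apply/eqP => /ival_inj E'; apply: zus; rewrite E'.
have [j [uj jt zj]] := rational_point_right (@neq_open z (z s) cz) zus ut'.
have [i [si ij zi]] := rational_point_right (@neq_open z (z (rational_point R
  j)) cz)
  (not_eq_sym zj) (lt_trans su' uj).
have [n nE] : exists n, ~ E n (z (rational_point R i)) (z (rational_point R j)).
  apply: contrapT => H; apply/zi/(cu_sep hE) => n; apply: contrapT => h.
  by apply: H; exists n.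
have := minz _ (cut_regular st zst rz) (fun k => @cut_still z s t k zst)
  (pickle (i, j, n)).
rewrite /still pickleK /= => H; apply/nE/H => [v w|]; last by rewrite !lexx ltW.
move=> /andP[/andP[iv vj] /andP[iw wj]]; rewrite /cut_path.
rewrite (le_trans (ltW si) iv) (le_trans vj (ltW jt)).
by rewrite (le_trans (ltW si) iw) (le_trans wj (ltW jt)); exact: (cu_refl hE).
Qed.

(** Distinct continuous paths are told apart by a pixel at a rational time. *)
Let avoid (k : nat) : set Z := if (unpickle k : option (nat * {l : nat & 'I_(N
  l)})) is
    Some jli then [set z | ~ O (tagged jli.2) (z (rational_point R jli.1))]
  else setT.

Let avoid_closed k : closed (avoid k).
Proof.
rewrite /avoid; case: unpickle => [jli|]; last exact: closedT.
have /continuous_closedP := @path_eval_continuous R T (rational_point R jli.1).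
by move=> /(_ _ (open_closedC (pixel_open hO (tagged jli.2)))).
Qed.

Let decided_eq d z z' : regular_paths d z -> regular_paths d z' ->
  (forall k, avoid k z -> avoid k z') -> z = z'.
Proof.
move=> /regular_paths_continuous cz /regular_paths_continuous cz' zz'.
apply/funext => t; apply: contrapT => nzt.
pose V := ~` [set v | forall n, E n (z v) (z' v)].
have oV : open V.
  apply: closed_openC; rewrite (_ : [set v | _] =
      \bigcap_n ((fun v => (z v, z' v)) @^-1` [set pq : T * T | E n pq.1 pq.2])).
    apply: closed_bigI => n _.
    have /continuous_closedP := pair_continuous cz cz'.
    by move=> /(_ _ (@cu_closed _ _ hE n)).
  by apply/seteqP; split=> v /= H; [move=> n _|move=> n]; exact: H.
have Vt : V t by move=> H; apply/nzt/(cu_sep hE).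
have [j Vj] := rational_point_open oV Vt.
have [l nl] : exists l, ~ E l (z (rational_point R j)) (z' (rational_point R j)).
  by apply: contrapT => H; apply: Vj => l; apply: contrapT => h; apply: H; exists l.
have [i il] := pixel_cover hO l (z' (rational_point R j)).
have := zz' (pickle (j, existT (fun l => 'I_(N l)) l i)).
rewrite /avoid pickleK /= => H.
have ilz : O i (z (rational_point R j)) by apply: contrapT => h; exact: H h il.
exact: nl (pixel_small hO ilz il).
Qed.

Variable f : nat -> T -> R.
Hypotheses (cf : forall i, continuous (f i)) (f01 : forall i p, 0 <= f i p <= 1).
Hypothesis fsep : forall p q, (forall i, f i p = f i q) -> p = q.
Hypothesis xy : forall d, x d <> y d.

(** Of the Hilbert cube the argument uses compactness, the entourages with
    their pixels, and a separating sequence of functions; of the triples, only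
    that they depend continuously on the parameter. *)
Lemma borel_arc_selection : exists A : D -> hyperspace T,
  borel_measurable A /\
  forall d, A d `<=` X d /\ arc_with_endpoints R (A d) (x d) (y d).
Proof.
have cZ := @path_space_compact R T cT.
have [F1 [mF1 clF1 neF1 F1r [_ F1min]]] := greedy_refinement sB cZ
  regular_paths_measurable regular_paths_closed regular_paths_nonempty still_closed.
have F1lf d z : F1 d z -> loop_free z.
  move=> Fz; apply: (@minimal_loop_free d z (F1r d z Fz)) => z' rz'.
  exact: (F1min d z z' Fz rz').
have [F2 [mF2 _ neF2 F21 [F2dec _]]] := greedy_refinement sB cZ mF1 clF1 neF1
  avoid_closed.
pose g d : Z := projT1 (cid (neF2 d)).
have gF d : F2 d (g d) := projT2 (cid (neF2 d)).
have gr d : regular_paths d (g d) by apply: F1r; exact: F21.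
have F2g d z : F2 d z -> z = g d.
  move=> Fz; apply: (@decided_eq d) => //; first exact/F1r/F21.
  by move=> k; exact: (F2dec d z (g d) k Fz (gF d)).
have cg d : continuous (g d) by exact: regular_paths_continuous (gr d).
have gne d : range (g d) !=set0 by exists (g d (unit_interval0 R)),
  (unit_interval0 R).
have gc d : compact (range (g d)).
  apply: continuous_compact; last exact: unit_interval_compact.
  exact/continuous_subspaceT/cg.
exists (fun d => Hyperspace (gne d) (gc d)); split; last first.
  move=> d; have [[g0 g1 gX] _] := gr d; split; first by move=> _ [t _ <-];
    exact: gX.
  rewrite -g0 -g1; apply: (loop_free_arc (cu_hausdorff hE) cf f01 fsep (cg d)).
    exact: (F1lf d _ (F21 d _ (gF d))).
  by rewrite g0 g1; exact: xy.
have hit_measurable l (i : 'I_(N l)) : B [set d | range (g d) `&` O i !=set0].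
  pose k (j : nat) := pickle (j, existT (fun l => 'I_(N l)) l i).
  rewrite [X in B X](_ : _ = [set d | exists j, (~` [set d | F2 d `&` avoid (k
    j) !=set0]) d]).
    have mk j : B [set d | F2 d `&` avoid (k j) !=set0] := mF2 _ (@avoid_closed
      (k j)).
    exact: (sig_bigcup sB (fun j => sigC sB (mk j))).
  apply/seteqP; split=> d /=.
    move=> [_ [[t _ <-] gt]].
    have oV : open (g d @^-1` O i).
      by move/continuousP: (cg d) => /(_ _ (pixel_open hO i)).
    have [j gj] := rational_point_open oV gt.
    exists j => -[z [/F2g -> ]]; rewrite /avoid /k pickleK /=; exact.
  move=> [j H]; exists (g d (rational_point R j)); split;
    first by exists (rational_point R j).
  apply: contrapT => nO; apply: H; exists (g d); split; first exact: gF.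
  by rewrite /avoid /k pickleK.
move=> U oU; rewrite [X in B X](_ : _ = [set d | exists lS : {l : nat & {set
  'I_(N l)}},
    (forall K : hyperspace T, hit O (tag lS) K = tagged lS -> U K) /\
    hit O (tag lS) (range (g d)) = tagged lS]).
  apply: (sig_bigcup sB) => -[l S] /=.
  rewrite [X in B X](_ : _ = [set d | (forall K : hyperspace T, hit O l K = S
    -> U K) /\
      pred1 S [set i | `[< range (g d) `&` O i !=set0 >]]%SET]).
    apply: (sigI sB (sig_cst sB _)).
    exact: (@sig_finpred _ _ sB _ (fun d i => range (g d) `&` O i !=set0)
      (pred1 S)).
  by apply/seteqP; split=> d /= [h1 h2]; split=> //; apply/eqP.
apply/seteqP; split=> d /=.
  move=> /(vietoris_pixels hE cT hO oU) [l lU].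
  by exists (existT _ l (hit O l (range (g d)))).
by move=> [[l S] /= [H hS]]; exact: H.
Qed.

End selection.

(** * The Hilbert cube *)

Section separating_functions.
Variables (R : realType) (T : topologicalType) (f : nat -> T -> R).
Hypothesis cf : forall i, continuous (f i).
Hypothesis fsep : forall p q, (forall i, f i p = f i q) -> p = q.

Definition function_uniformity n p q :=
  forall i, (i < n)%N -> `|f i p - f i q| <= 2^-1 ^+ n.

Lemma function_uniformityP : closed_uniformity function_uniformity.
Proof.
have w0 n : 0 < 2^-1 ^+ n :> R by rewrite exprn_gt0 // invr_gt0 ltr0n.
split.
- by [].
- by move=> n p i _; rewrite subrr normr0 ltW.
- by move=> n p q pq i ni; rewrite distrC; exact: pq.
- move=> n p q r pq qr i ni; have := pq i (ltnW ni); have := qr i (ltnW ni).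
  have := ler_normD (f i p - f i q) (f i q - f i r); rewrite addrA subrK exprS.
  lra.
- move=> p q pq; apply: fsep => i; apply/eqP; rewrite -subr_eq0 -normr_le0.
  apply/ler_addgt0Pl => e e0; rewrite addr0.
  have := @cvg_expr R 2^-1; rewrite ger0_norm ?invr_ge0 ?ler0n // invf_lt1
    ?ltr1n // => /(_ isT).
  move/cvgrPdist_le => /(_ e e0) [n _ /(_ (maxn n i.+1) (leq_maxl _ _))].
  rewrite /= sub0r normrN ger0_norm; last exact: ltW.
  exact/le_trans/pq/leq_maxr.
- move=> n p; suff : forall m, nbhs p [set q | forall i, (i < m)%N -> `|f i p -
  f i q| <= 2^-1 ^+ n].
    exact.
  elim=> [|m IH]; first by apply: filterS filterT => q _ i.
  have /continuous_distP /(_ _ (w0 n)) := @cf m p.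
  apply: filterS2 IH => q qm qp i; rewrite ltnS leq_eqVlt => /predU1P[->//|];
    exact: qm.
move=> n; rewrite (_ : [set pq | _] = \bigcap_(i in [set i | (i < n)%N])
    ((fun pq : T * T => `|f i pq.1 - f i pq.2|) @^-1` [set r : R | r <= 2^-1 ^+
      n])).
  apply: closed_bigI => i _.
  suff /continuous_closedP : continuous (fun pq : T * T => `|f i pq.1 - f i
    pq.2| : R).
    by apply; exact: closed_le.
  have c1 : continuous (fun pq : T * T => f i pq.1).
    by apply: (@comp_continuous _ T R fst (f i)) => // pq; exact: cvg_fst.
  have c2 : continuous (fun pq : T * T => f i pq.2).
    by apply: (@comp_continuous _ T R snd (f i)) => // pq; exact: cvg_snd.
  by move=> pq; apply: cvg_norm; apply: cvgB; [exact: c1|exact: c2].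
by apply/seteqP; split=> pq h i; exact: h.
Qed.

End separating_functions.

Lemma set_type_connected (T : topologicalType) (K : set T) :
  connected [set: set_type K] -> connected K.
Proof.
move=> cK; rewrite (_ : K = set_val @` [set: set_type K]).
  apply: connected_continuous_connected => //.
  exact/continuous_subspaceT/set_val_continuous.
apply/seteqP; split=> [p Kp|_ [p _ <-]]; last exact: set_valP.
by exists (exist _ p (mem_set Kp)) => //; rewrite set_valE.
Qed.

Lemma set_type_locally_connected (T : topologicalType) (K : set T) :
  locally_connected (set_type K) -> forall p U, K p -> nbhs p U ->
  exists V W, [/\ V `<=` K `&` U, connected V, nbhs p W & K `&` W `<=` V].
Proof.
move=> lcK p U Kp pU; pose p' : set_type K := exist _ p (mem_set Kp).
have p'U : nbhs p' (set_val @^-1` U).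
  by apply: (@set_val_continuous _ K p'); rewrite set_valE.
have [V [[W oW WV] Vp cV VU]] := lcK p' _ p'U.
exists (set_val @` V), W; split.
- by move=> _ [q Vq <-]; split; [exact: set_valP|exact: VU].
- apply: connected_continuous_connected => //.
  exact/continuous_subspaceT/set_val_continuous.
- by apply: open_nbhs_nbhs; split=> //; move: Vp; rewrite -WV /= set_valE.
move=> q [Kq Wq]; exists (exist _ q (mem_set Kq)); last by rewrite set_valE.
by rewrite -WV /= set_valE.
Qed.

Section hilbert_cube.
Variable R : realType.

Definition cube_coord (n : nat) (p : hilbert_cube R) : R := ival (p n).

Lemma cube_coord_continuous n : continuous (cube_coord n).
Proof.
apply: (@comp_continuous _ (unit_interval R) R (fun p : hilbert_cube R => p n)
  (@ival R)).
  exact: (@proj_continuous nat (fun=> unit_interval R) n).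
exact: ival_continuous.
Qed.

Lemma cube_coord01 n p : 0 <= cube_coord n p <= 1.
Proof. by rewrite /cube_coord ival_ge0 ival_le1. Qed.

Lemma cube_coord_sep p q : (forall n, cube_coord n p = cube_coord n q) -> p = q.
Proof. by move=> pq; apply/funext => n; apply/ival_inj/pq. Qed.

Lemma hilbert_cube_compact : compact [set: hilbert_cube R].
Proof.
have := @tychonoff nat (fun=> unit_interval R) (fun=> setT) (fun=>
  @unit_interval_compact R).
by congr compact; apply/seteqP; split.
Qed.

End hilbert_cube.

Theorem theoremC (R : realType) :
  exists A : set_type (arc_domain R) -> hyperspace (hilbert_cube R),
    borel_measurable A /\
    forall d : set_type (arc_domain R),
      let: (X, x, y) := set_val d in
      A d `<=` set_val X /\ arc_with_endpoints R (A d) x y.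
Proof.
have hE := function_uniformityP (@cube_coord_continuous R) (@cube_coord_sep R).
have cQ := @hilbert_cube_compact R.
have [N [pix hO]] := pixels_exist hE cQ.
pose X (d : set_type (arc_domain R)) : hyperspace (hilbert_cube R) := set_val
  (set_val d).1.1.
pose x (d : set_type (arc_domain R)) : hilbert_cube R := (set_val d).1.2.
pose y (d : set_type (arc_domain R)) : hilbert_cube R := (set_val d).2.
have c1 : continuous (fun d : set_type (arc_domain R) => (set_val d).1).
  by apply: (@comp_continuous _ _ _ set_val fst);
    [exact: set_val_continuous|move=> p; exact: cvg_fst].
have cX : continuous X.
  apply: (@comp_continuous _ _ _ (fun d : set_type (arc_domain R) => (set_val
    d).1.1) set_val).
    by apply: (@comp_continuous _ _ _ _ fst c1) => p; exact: cvg_fst.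
  exact: set_val_continuous.
have cx : continuous x.
  by apply: (@comp_continuous _ _ _ _ snd c1) => p; exact: cvg_snd.
have cy : continuous y.
  by apply: (@comp_continuous _ _ _ set_val snd);
    [exact: set_val_continuous|move=> p; exact: cvg_snd].
have domP d : [/\ hyperspace_set (X d) (x d), hyperspace_set (X d) (y d) & x d
  <> y d].
  have : arc_domain R (set_val d) by exact: set_valP.
  by rewrite /X /x /y; case: (set_val d) => [[? ?] ?].
have peanoX d : peano_continuum R (set_type (X d)) by exact: (set_valP (set_val
  d).1.1).
have [A [bA arcA]] : exists A : set_type (arc_domain R) -> hyperspace
  (hilbert_cube R),
    borel_measurable A /\
    forall d, A d `<=` X d /\ arc_with_endpoints R (A d) (x d) (y d).
  apply: (borel_arc_selection hE cQ hO cX cx cy _ _ _ _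
    (@cube_coord_continuous R) (@cube_coord01 R) (@cube_coord_sep R)).
  - by move=> d; have [] := domP d.
  - by move=> d; have [] := domP d.
  - move=> d; have [[_ _ cnX _] _] := peanoX d; exact: set_type_connected.
  - move=> d p U; have [_ lcX] := peanoX d; exact: set_type_locally_connected.
  - by move=> d; have [] := domP d.
exists A; split=> // d; have := arcA d; rewrite /X /x /y.
by case: (set_val d) => [[? ?] ?].
Qed.
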